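(* Let $(\epsilon(n))_{n\ge1}$ be a sequence of positive real numbers with $\epsilon(n)\to0$ as $n\to\infty$. Then there exists a Menshov spectrum in measure $\Lambda=\{\lambda(1)<\lambda(2)<\lambda(3)<\cdots\}\subset\mathbb{Z}^+$ such that $$\frac{\lambda(n+1)}{\lambda(n)}>1+\epsilon(n)\qquad\text{for all } n=1,2,\ldots$$
   Context: $\mathbb{Z}^+=\{1,2,\ldots\}$; $\mathbb{T}=\mathbb{R}/2\pi\mathbb{Z}$ with normalized Lebesgue measure; $L^0(\mathbb{T})$ is the space of all measurable functions $f:\mathbb{T}\to\mathbb{C}$. A set $\Lambda\subset\mathbb{Z}$ is a Menshov spectrum in measure if for every $f\in L^0(\mathbb{T})$ there are complex coefficients $(c_k)_{k\in\Lambda}$ such that the partial sums $\sum_{k\in\Lambda,\,|k|\le N}c_k e^{ikt}$ converge to $f$ in measure on $\mathbb{T}$ as $N\to\infty$. *)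

(* Defs.v *)
From HB Require Import structures.
From mathcomp Require Import all_boot all_order all_algebra.
From mathcomp Require Export complex.
From mathcomp Require Import all_classical all_reals all_analysis.
Set Implicit Arguments.
Unset Strict Implicit.
Unset Printing Implicit Defensive.
Import Order.TTheory GRing.Theory Num.Theory.
Import numFieldNormedType.Exports.
Local Open Scope classical_set_scope.
Local Open Scope complex_scope.
Local Open Scope ring_scope.

(* Functions on the circle R / 2 pi Z are represented
   by 2 pi-periodic functions on the line. *)

(* The line with the sigma-algebra of Lebesgue measurable sets (the domain of
   [completed_lebesgue_measure]), as opposed to the Borel [measurableTypeR]. *)
Definition lebesgueTypeR (R : realType) : measurableType _ :=
  caratheodory_type ((@wlength R idfun)^*)%mu.

Definition circle_measure (R : realType) (A : set R) : \bar R :=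
  (((pi *+ 2)^-1)%:E *
   completed_lebesgue_measure (A `&` `[0%R, (pi *+ 2)%R[%classic))%E.

(* Functions are not identified up to almost everywhere equality. *)
Definition L0_circle (R : realType) (f : R -> R[i]) : Prop :=
  [/\ periodic f (pi *+ 2),
      measurable_fun setT
        ((fun t => complex.Re (f t)) : lebesgueTypeR R -> measurableTypeR R) &
      measurable_fun setT
        ((fun t => complex.Im (f t)) : lebesgueTypeR R -> measurableTypeR R)].

Definition cvg_in_circle_measure (R : realType)
    (S : nat -> R -> R[i]) (f : R -> R[i]) : Prop :=
  forall e : R, 0 < e ->
    circle_measure [set t | e%:C < `|S N t - f t|] @[N --> \oo] --> (0%R)%:E.

Definition expi (R : realType) (x : R) : R[i] := cos x +i* sin x.

(* Only the values of [c] on [Lambda] matter. *)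
Definition spectral_partial_sum (R : realType) (Lambda : set int)
    (c : int -> R[i]) (N : nat) (t : R) : R[i] :=
  \sum_(k \in Lambda `&` [set k : int | `|k| <= N%:Z]) c k * expi (k%:~R * t).

Definition menshov_spectrum_in_measure (R : realType) (Lambda : set int) : Prop :=
  forall f : R -> R[i], L0_circle f ->
    exists c : int -> R[i],
      cvg_in_circle_measure (spectral_partial_sum Lambda c) f.

Arguments menshov_spectrum_in_measure : clear implicits.

(* Main.v *)
(* Call a trigonometric polynomial with positive frequencies analytic. The crux is
   that for all d, k > 0 there is C such that for every k1 > 0 some analytic A
   satisfies |A - 1| <= d off a set of measure k1, while each partial sum of A is
   bounded by C off a set of measure k. Such A is reached from r = 1 by repeatedly
   replacing r with r + theta(|r|^2) r (F(z^n) - 1), n large, where theta(|r|^2) is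
   close to the indicator of {|r| > d} and F is analytic up to the constant term
   F(0) = 1, with tiny other coefficients, and very small on a set of measure at
   least a universal c > 0. One step multiplies the measure of {|r| > d} by 1 - c
   and, off that set, adds only small partial sums; so C depends on the first few
   steps only. F is prod_j (1 + a z^(q^j) / m)^m, of modulus about
   exp(a sum_j cos(q^j t)), and c comes from the first four moments of the
   lacunary cosine sum.

   Averaging M dilates A(n_i t), M large compared to C, gives analytic functions
   whose partial sums are all nearly constant in measure and end near 1. Hence any
   trigonometric polynomial h is close to
   sum_i sum_m (a_m / M) e^(imt) A(n_(i,m) t), with partial sums close to
   multiples q h, 0 <= q <= 1. For fast growing n_(i,m) the consecutive ratios of
   its spectrum are at least 1 + 1 / (deg A + 1), and this exceeds 1 + eps once
   enough lacunary filler precedes the block. The spectrum is the union of such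
   blocks for degrees tending to infinity; a measurable f is expanded greedily,
   approximating each remainder in measure by a trigonometric polynomial. *)
From HB Require Import structures.
Require Import Defs.
From mathcomp Require Import all_boot all_order all_algebra.
From mathcomp Require Import all_classical all_reals all_analysis measurable_realfun.
From mathcomp Require Import ring lra zify.
Set Implicit Arguments.
Unset Strict Implicit.
Unset Printing Implicit Defensive.
Import Order.TTheory GRing.Theory Num.Theory.
Import numFieldNormedType.Exports.
Local Open Scope classical_set_scope.
Local Open Scope complex_scope.
Local Open Scope ring_scope.
Local Notation Re := complex.Re.
Local Notation Im := complex.Im.

(** * Modulus and normalized outer measure *)

Section modulus.
Context {R : realType}.
Implicit Types x y : R[i].

Definition nm x : R := Re `|x|.

Lemma nmE x : (nm x)%:C = `|x|.
Proof. by rewrite /nm normc_def. Qed.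

Lemma nm_ge0 x : 0 <= nm x.
Proof. by rewrite /nm normc_def /= sqrtr_ge0. Qed.

Lemma nm_le x (e : R) : (nm x <= e) = (`|x| <= e%:C).
Proof. by rewrite -nmE lecR. Qed.

Lemma nmD x y : nm (x + y) <= nm x + nm y.
Proof. by rewrite nm_le rmorphD /= !nmE ler_normD. Qed.

Lemma nmM x y : nm (x * y) = nm x * nm y.
Proof. by apply: complexI; rewrite rmorphM /= !nmE normrM. Qed.

Lemma nmN x : nm (- x) = nm x.
Proof. by rewrite /nm normrN. Qed.

Lemma nmB x y : nm (x - y) <= nm x + nm y.
Proof. by rewrite -(nmN y) nmD. Qed.

Lemma nm_distC x y : nm (x - y) = nm (y - x).
Proof. by rewrite -nmN opprB. Qed.

Lemma nm0 : nm 0 = 0 :> R.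
Proof. by rewrite /nm normr0. Qed.

Lemma nm1 : nm 1 = 1 :> R.
Proof. by rewrite /nm normr1. Qed.

Lemma nmX x n : nm (x ^+ n) = nm x ^+ n.
Proof. by elim: n => [|n ih]; rewrite ?expr0 ?nm1// !exprS nmM ih. Qed.

Lemma nm_real (a : R) : nm a%:C = `|a|.
Proof. by rewrite /nm normc_def /= expr0n addr0 sqrtr_sqr. Qed.

Lemma nm_sum (I : Type) (r : seq I) (P : pred I) (F : I -> R[i]) :
  nm (\sum_(i <- r | P i) F i) <= \sum_(i <- r | P i) nm (F i).
Proof.
elim/big_rec2: _ => [|i a b _ h]; first by rewrite nm0.
exact: le_trans (nmD _ _) (lerD _ _).
Qed.

Lemma nm_sqr x : (nm x ^+ 2)%:C = x * (conjc x).
Proof. by rewrite rmorphXn /= nmE sqr_normc. Qed.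

Lemma nm_sqrE x : nm x ^+ 2 = Re x ^+ 2 + Im x ^+ 2.
Proof. by apply: complexI; rewrite rmorphXn /= nmE -add_Re2_Im2. Qed.

Lemma nm_triangle x y z : nm (x - z) <= nm (x - y) + nm (y - z).
Proof. by rewrite (_ : x - z = (x - y) + (y - z)) ?nmD// addrA subrK. Qed.

Lemma expiD (s t : R) : expi (s + t) = expi s * expi t.
Proof. by rewrite /expi cosD sinD; apply/eqP; rewrite eq_complex /= eqxx addrC eqxx. Qed.

Lemma expi0 : expi 0 = 1 :> R[i].
Proof. by rewrite /expi cos0 sin0. Qed.

Lemma expiMn (t : R) n : expi (n%:R * t) = expi t ^+ n.
Proof.
elim: n => [|n ih]; first by rewrite mul0r expi0.
by rewrite -natr1 mulrDl mul1r expiD ih exprSr.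
Qed.

Lemma nm_expi (t : R) : nm (expi t) = 1.
Proof.
apply/eqP; rewrite -(@eqrXn2 _ 2) ?nm_ge0// nm_sqrE /expi /= expr1n.
by rewrite cos2Dsin2.
Qed.

Lemma expi_neq0 (t : R) : expi t != 0 :> R[i].
Proof. by apply/eqP => h; have := nm_expi t; rewrite h nm0 => /eqP; rewrite eq_sym oner_eq0. Qed.

Lemma conjc_expi (t : R) : conjc (expi t) = (expi t)^-1.
Proof.
apply: (mulfI (expi_neq0 t)); rewrite divff ?expi_neq0// -nm_sqr nm_expi.
by rewrite expr1n.
Qed.

End modulus.

Section circle.
Context {R : realType}.
Implicit Types A B : set R.

(** An outer measure, hence monotone and subadditive on arbitrary sets; measurability first enters
    with complements, in [cmuC]. *)
Definition cmu A : R := fine (circle_measure A).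

Let pi2_gt0 : 0 < pi *+ 2 :> R.
Proof. by rewrite pmulrn_rgt0// pi_gt0. Qed.

Let I0 : set R := `[0%R, (pi *+ 2)%R[%classic.

Let outer (A : set R) : \bar R := ((@wlength R idfun)^*)%mu A.

Lemma completed_outerE A : completed_lebesgue_measure A = outer A.
Proof. by []. Qed.

Lemma lebesgue_outerE A : lebesgue_measure A = outer A.
Proof. by []. Qed.

Lemma outer_I0 : outer I0 = (pi *+ 2)%:E.
Proof.
rewrite -lebesgue_outerE /I0 lebesgue_measure_itv/= lte_fin pi2_gt0.
by rewrite oppr0 addr0.
Qed.

Lemma circle_measure_le A B : A `<=` B -> (circle_measure A <= circle_measure B)%E.
Proof.
move=> AB; rewrite /circle_measure lee_pmul2l// ?lte_fin ?invr_gt0//.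
by apply: le_outer_measure; apply: setSI.
Qed.

Lemma circle_measureT : circle_measure [set: R] = 1%E.
Proof.
rewrite /circle_measure setTI completed_outerE outer_I0 -EFinM mulVf//.
by rewrite gt_eqF.
Qed.

Lemma circle_measure_ge0 A : (0 <= circle_measure A)%E.
Proof.
by rewrite /circle_measure mule_ge0// ?lee_fin ?invr_ge0 ?(ltW pi2_gt0)//; exact: outer_measure_ge0.
Qed.

Lemma cmuE A : circle_measure A = (cmu A)%:E.
Proof.
rewrite fineK// ge0_fin_numE ?circle_measure_ge0//.
by rewrite (le_lt_trans (circle_measure_le (@subsetT _ A)))// circle_measureT ltry.
Qed.

Lemma cmu_ge0 A : 0 <= cmu A.
Proof. by rewrite -lee_fin -cmuE circle_measure_ge0. Qed.

Lemma cmuT : cmu setT = 1.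
Proof. by rewrite /cmu circle_measureT. Qed.

Lemma cmu_le A B : A `<=` B -> cmu A <= cmu B.
Proof. by move=> AB; rewrite -lee_fin -!cmuE circle_measure_le. Qed.

Lemma cmu_le1 A : cmu A <= 1.
Proof. by rewrite -cmuT cmu_le. Qed.

Lemma cmuU A B : cmu (A `|` B) <= cmu A + cmu B.
Proof.
rewrite -lee_fin EFinD -!cmuE /circle_measure -muleDr//; last first.
  by apply: ge0_adde_def; rewrite inE; exact: outer_measure_ge0.
rewrite lee_pmul2l// ?lte_fin ?invr_gt0// setIUl.
exact: outer_measureU2.
Qed.

Lemma cmu_leU A B D : A `<=` B `|` D -> cmu A <= cmu B + cmu D.
Proof. by move=> h; exact: le_trans (cmu_le h) (cmuU _ _). Qed.

Lemma cmu_borel A : measurable A ->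
  (cmu A)%:E = ((pi *+ 2)^-1%:E * lebesgue_measure (A `&` I0))%E.
Proof. by rewrite -cmuE. Qed.

Lemma cmuC A : measurable (A : set (measurableTypeR R)) -> cmu A + cmu (~` A) = 1.
Proof.
move=> mA; apply: EFin_inj; rewrite EFinD !cmu_borel//; last exact: measurableC.
rewrite -muleDr//; last by apply: ge0_adde_def; rewrite inE.
rewrite -measureU//=.
- rewrite -setIUl setUv setTI lebesgue_outerE outer_I0 -EFinM mulVf//.
  by rewrite gt_eqF.
- by apply: measurableI => //; exact: measurable_itv.
- apply: measurableI; [exact: measurableC|exact: measurable_itv].
- by rewrite setIACA setICr set0I.
Qed.

End circle.

(** * Trigonometric polynomials and their means *)

Section trig.
Context {R : realType}.
Implicit Types (G H : R -> R[i]) (c d : R[i]) (g h : {poly R[i]}).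

Lemma conjcM (x y : R[i]) : conjc (x * y) = conjc x * conjc y.
Proof. exact: rmorphM. Qed.

Lemma conjcX (x : R[i]) n : conjc (x ^+ n) = conjc x ^+ n.
Proof. exact: rmorphXn. Qed.

Lemma conjc_sum n (F : 'I_n -> R[i]) :
  conjc (\sum_(i < n) F i) = \sum_(i < n) conjc (F i).
Proof. exact: rmorph_sum. Qed.

Lemma mulVXn (x : R[i]) i n : x != 0 -> (i <= n)%N ->
  x^-1 ^+ (n - i) * x ^+ n = x ^+ i.
Proof.
by move=> x0 /subnK {2}<-; rewrite exprVn exprD mulrA mulVf ?mul1r// expf_neq0.
Qed.

(** With z = e^(it), G is z^(-D) g(z) with deg g <= 2D, a trigonometric polynomial of degree at most
    D. Its mean c is read off as the middle coefficient, which turns integral identities into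
    polynomial algebra. *)
Definition trigm (D : nat) G c := exists g, [/\ (size g <= D.*2.+1)%N,
  forall t, G t * expi t ^+ D = g.[expi t] & g`_D = c].

Lemma eq_trigm D G H c : G =1 H -> trigm D G c -> trigm D H c.
Proof. by move=> GH [g [sg Gg gc]]; exists g; split=> // t; rewrite -GH. Qed.

Lemma trigm_cst c : trigm 0 (fun=> c) c.
Proof.
exists c%:P; split; rewrite ?coefC//; last by move=> t; rewrite expr0 mulr1 hornerC.
by rewrite size_polyC; case: eqP.
Qed.

Lemma trigm_addn k D G c : trigm D G c -> trigm (k + D) G c.
Proof.
move=> [g [sg Gg gc]]; exists (g * 'X^k); split.
- apply: leq_trans (size_polyMleq _ _) _; rewrite size_polyXn; lia.
- by move=> t; rewrite hornerM hornerXn -Gg -mulrA -exprD addnC.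
- by rewrite coefMXn ltnNge leq_addr /= addKn.
Qed.

Lemma trigm_le D D' G c : (D <= D')%N -> trigm D G c -> trigm D' G c.
Proof. by move=> /subnK <-; exact: trigm_addn. Qed.

Lemma trigmD D G H c d : trigm D G c -> trigm D H d -> trigm D (G \+ H) (c + d).
Proof.
move=> [g [sg Gg gc]] [h [sh Hh hd]]; exists (g + h); split.
- by rewrite (leq_trans (size_polyD _ _))// geq_max sg.
- by move=> t; rewrite /= mulrDl Gg Hh hornerD.
- by rewrite coefD gc hd.
Qed.

Lemma trigmZ D G c a : trigm D G c -> trigm D (fun t => a * G t) (a * c).
Proof.
move=> [g [sg Gg gc]]; exists (a *: g); split.
- by rewrite (leq_trans (size_scale_leq _ _)).
- by move=> t; rewrite /= -mulrA Gg hornerZ.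
- by rewrite coefZ gc.
Qed.

Lemma trigmM D E G H c d : trigm D G c -> trigm E H d ->
  exists b, trigm (D + E) (G \* H) b.
Proof.
move=> [g [sg Gg gc]] [h [sh Hh hd]]; exists (g * h)`_(D + E), (g * h); split=> //.
- by apply: leq_trans (size_polyMleq _ _) _; move: sg sh; lia.
- by move=> t; rewrite hornerM -Gg -Hh /= exprD mulrACA.
Qed.

(** The frequencies of G lie in [-D, D] and those of H(nt) are multiples of n > D, so two of them
    cancel only if both are 0 and the mean of the product factors. This replaces independence in
    what follows. *)
Lemma trigm_dil D E n G H c d : (D < n)%N -> trigm D G c -> trigm E H d ->
  trigm (D + n * E) (fun t => G t * H (n%:R * t)) (c * d).
Proof.
move=> Dn [g [sg Gg gc]] [h [sh Hh hd]].
have n0 : (0 < n)%N by exact: leq_ltn_trans Dn.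
exists (g * (h \Po 'X^n)); split.
- apply: leq_trans (size_polyMleq _ _) _.
  have := size_comp_poly_leq h 'X^n; rewrite size_polyXn /=.
  have : ((size h).-1 * n <= (n * E).*2)%N.
    by rewrite doubleMr mulnC leq_mul2l; apply/orP; right; move: sh; lia.
  move: ((size h).-1 * n)%N (n * E)%N (size (h \Po 'X^n)) sg => k l m.
  by move: (size g) => sg; lia.
- move=> t; rewrite hornerM -Gg horner_comp hornerXn.
  by have := Hh (n%:R * t); rewrite expiMn => <-; rewrite -exprM exprD mulrACA.
- rewrite coefM -gc -hd.
  have Dlt : (D < (D + n * E).+1)%N by rewrite ltnS leq_addr.
  rewrite (bigD1 (Ordinal Dlt)) //= [X in _ + X]big1 ?addr0 => [|i iD].
    by rewrite addKn coef_comp_poly_Xn// dvdn_mulr// mulKn.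
  have [si|si] := leqP (size g) i; first by rewrite nth_default ?mul0r.
  rewrite coef_comp_poly_Xn//; case: ifP => [|_]; last by rewrite mulr0.
  (* If i + nk = D + nE with i <= 2D and i different from D, then n divides a nonzero integer of
     modulus at most D < n. *)
  have iD' : (i != D :> nat)%N.
    by apply: contra iD => /eqP h0; apply/eqP/val_inj.
  move=> /dvdnP [k hk]; exfalso.
  have := ltn_ord i; move: si sg iD' hk Dn.
  move: (nat_of_ord i) => j; move: (size g) => sz.
  case: (ltngtP k E) => [/subnKC <-|/subnKC <-|->]; last by rewrite mulnC; lia.
    by rewrite [(n * _)%N]mulnC !mulnDl mulSn; lia.
  by rewrite [(n * _)%N]mulnC !mulnDl mulSn; lia.
Qed.

(** On the circle conj z = 1/z, so conjugation reverses the 2D + 1 coefficients and conjugates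
    each. *)
Lemma trigm_conj D G c : trigm D G c -> trigm D (fun t => conjc (G t)) (conjc c).
Proof.
move=> [g [sg Gg gc]].
exists (\poly_(k < D.*2.+1) conjc g`_(D.*2 - k)); split.
- exact: size_poly.
- move=> t; rewrite horner_poly.
  have z0 := expi_neq0 t.
  have -> : conjc (G t) = conjc (g.[expi t]) * expi t ^+ D.
    rewrite -Gg conjcM conjcX conjc_expi -mulrA -exprMn mulVf//.
    by rewrite expr1n mulr1.
  rewrite -mulrA -exprD addnn (horner_coef_wide _ sg) conjc_sum mulr_suml.
  rewrite (reindex_inj rev_ord_inj) /=; apply: eq_bigr => i _.
  have iD : (i <= D.*2)%N by rewrite -ltnS.
  rewrite subSS conjcM conjcX conjc_expi -mulrA; congr (_ * _).
  by rewrite -{1}(subKn iD) mulVXn ?leq_subr// subKn.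
- rewrite coef_poly (_ : D.*2 - D = D)%N ?gc; last by lia.
  by case: ltnP => //; lia.
Qed.

Lemma trigm_horner (p : {poly R[i]}) : trigm (size p) (fun t => p.[expi t]) p`_0.
Proof.
exists (p * 'X^(size p)); split.
- by apply: leq_trans (size_polyMleq _ _) _; rewrite size_polyXn; lia.
- by move=> t; rewrite hornerM hornerXn.
- by rewrite coefMXn ltnn subnn.
Qed.

(** Parseval: with n = [size p], z^n |p|^2 is p times its conjugate reversal, whose coefficient of
    index n is the sum of the |p_i|^2. *)
Lemma trigm_sqr_horner (p : {poly R[i]}) :
  trigm (size p) (fun t => (nm p.[expi t] ^+ 2)%:C) (\sum_(i < size p) nm p`_i ^+ 2)%:C.
Proof.
set n := size p; exists (p * \poly_(k < n.+1) conjc p`_(n - k)); split.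
- apply: leq_trans (size_polyMleq _ _) _.
  have := size_poly n.+1 (fun k => conjc p`_(n - k)); rewrite -/n.
  by move: n (size _) => a b; lia.
- move=> t; rewrite hornerM horner_poly nm_sqr -mulrA; congr (_ * _).
  have z0 := expi_neq0 t.
  have sp : (size p <= n.+1)%N by [].
  rewrite (horner_coef_wide _ sp) conjc_sum mulr_suml.
  rewrite (reindex_inj rev_ord_inj) /=; apply: eq_bigr => i _.
  have iD : (i <= n)%N by rewrite -ltnS.
  rewrite subSS conjcM conjcX conjc_expi -mulrA; congr (_ * _).
  by rewrite -{1}(subKn iD) mulVXn ?leq_subr// subKn.
- rewrite coefM rmorph_sum big_ord_recr /= [X in _ + X](_ : _ = 0) ?addr0.
    apply: eq_bigr => i _; rewrite nm_sqr coef_poly.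
    by rewrite ltnS leq_subr subKn// ltnW.
  by rewrite nth_default ?mul0r.
Qed.

End trig.

(** * Integrals of trigonometric polynomials and Markov's inequality *)

Section markov.
Context {R : realType}.
Implicit Types (c : R[i]) (t w : R) (k D : nat).

Lemma ReD (x y : R[i]) : Re (x + y) = Re x + Re y.
Proof. by case: x y => [a b] [c d]. Qed.

Lemma Re_sum n (F : 'I_n -> R[i]) : Re (\sum_(i < n) F i) = \sum_(i < n) Re (F i).
Proof.
elim: n F => [|n ih] F; first by rewrite !big_ord0.
by rewrite !big_ord_recl ReD ih.
Qed.

Let wave (c : R[i]) (w t : R) := Re c * cos (w * t) - Im c * sin (w * t).

(** A primitive of the real part of c e^(iwt). Frequency 0 gives a linear term, every other integer
    frequency a 2 pi-periodic one. *)
Let prim (c : R[i]) (w t : R) :=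
  if w == 0 then Re c * t else w^-1 * (Re c * sin (w * t) + Im c * cos (w * t)).

Lemma is_derive_prim c w t : is_derive t (1:R) (prim c w) (wave c w t).
Proof.
rewrite /prim /wave; have [->|w0] := eqVneq w 0.
  rewrite mul0r cos0 sin0 mulr0 subr0; apply: is_derive_eq.
  by rewrite /GRing.scale /= !mulr1.
apply: is_derive_eq.
rewrite /GRing.scale /= ?derive_val.
by field.
Qed.


Let freq D k : R := k%:R - D%:R.

Let trig_wave D (g : {poly R[i]}) t : (size g <= D.*2.+1)%N ->
  Re (g.[expi t] / expi t ^+ D) = \sum_(k < D.*2.+1) wave g`_k (freq D k) t.
Proof.
move=> sg; rewrite (horner_coef_wide _ sg) mulr_suml Re_sum; apply: eq_bigr => k _.
rewrite -mulrA (_ : _ / _ = expi (freq D k * t)).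
  by case: g`_k => a b; rewrite /expi /wave.
apply: (mulIf (expf_neq0 D (expi_neq0 t))).
by rewrite divfK ?expf_neq0 ?expi_neq0// -!expiMn -expiD -mulrDl subrK.
Qed.

(** The periodic terms cancel over [0, 2 pi]; only frequency 0, at index D, survives. *)
Let primE D (g : {poly R[i]}) :
  (\sum_(k < D.*2.+1) prim g`_k (freq D k) (pi *+ 2)) -
  (\sum_(k < D.*2.+1) prim g`_k (freq D k) 0) = Re g`_D * (pi *+ 2).
Proof.
have DD : (D < D.*2.+1)%N by lia.
rewrite -sumrB (bigD1 (Ordinal DD)) //= big1 ?addr0 => [|k kD].
  by rewrite /prim /freq subrr eqxx mulr0 subr0.
have w0 : freq D k != 0.
  rewrite subr_eq0 eqr_nat; apply: contra kD => /eqP h; exact/eqP/val_inj.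
rewrite /prim (negbTE w0) mulr0.
have per (f : R -> R) : periodic f (pi *+ 2) -> f (freq D k * (pi *+ 2)) = f 0.
  move=> pf; have pn n a : f (a + (pi *+ 2) *+ n) = f a by exact: periodicn.
  rewrite /freq; have [h|h] := leP D k.
    by rewrite -natrB// mulr_natl -[X in f X]add0r pn.
  by rewrite -opprB -natrB 1?ltnW// mulNr mulr_natl -(pn (D - k)%N) addNr.
rewrite (per _ (@sinD2pi R)) (per _ (@cosD2pi R)); lra.
Qed.

Lemma integral_trigm D (T : R -> R) c : trigm D (fun t => (T t)%:C) c ->
  continuous T /\
  (\int[lebesgue_measure]_(t in `[0%R, (pi *+ 2)%R]) (T t)%:E = (Re c * (pi *+ 2))%:E)%E.
Proof.
move=> [g [sg Tg gc]].
pose F t := \sum_(k < D.*2.+1) prim g`_k (freq D k) t.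
have TE : T = fun t => \sum_(k < D.*2.+1) wave g`_k (freq D k) t.
  apply/funext => t; rewrite -trig_wave// -Tg mulfK//.
  by rewrite expf_neq0// expi_neq0.
have dF t : is_derive t (1:R) F (T t).
  have -> : F = \sum_(k < D.*2.+1) prim g`_k (freq D k).
    by apply/funext => u; rewrite fct_sumE.
  rewrite TE /=; apply: is_derive_sum => k; exact: is_derive_prim.
have cT : continuous T.
  move=> t; apply/differentiable_continuous/derivable1_diffP.
  have -> : T = \sum_(k < D.*2.+1) wave g`_k (freq D k).
    by rewrite TE; apply/funext => u; rewrite fct_sumE.
  apply: derivable_sum => k; exact: ex_derive.
split=> //.
have cF : continuous F.
  move=> t; apply/differentiable_continuous/derivable1_diffP.
  by have [] := dF t.
rewrite (@continuous_FTC2 _ T F).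
- by rewrite -EFinB /F primE gc.
- by rewrite pmulrn_rgt0// pi_gt0.
- exact: continuous_subspaceT.
- split.
  + by move=> t _; have [] := dF t.
  + exact/cvg_at_right_filter/cF.
  + exact/cvg_at_left_filter/cF.
- by move=> t _; rewrite derive1E; exact: derive_val.
Qed.

(** Markov's inequality for an arbitrary A: the set where T >= 1 is measurable and contains A. *)
Lemma trigm_markov D (T : R -> R) c (A : set R) : trigm D (fun t => (T t)%:C) c ->
  (forall t, 0 <= T t) -> (forall t, A t -> 1 <= T t) -> cmu A <= Re c.
Proof.
move=> tT T0 T1; have [cT iT] := integral_trigm tT.
pose B : set R := [set t | 1 <= T t].
have AB : A `<=` B by move=> t /T1.
apply: le_trans (cmu_le AB) _.
have mB : measurable (B : set (measurableTypeR R)).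
  rewrite (_ : B = setT `&` T @^-1` `[1, +oo[%classic); last first.
    by rewrite setTI; apply/seteqP; split=> t; rewrite /B/= in_itv/= andbT.
  by apply: (continuous_measurable_fun cT) => //; exact: measurable_itv.
rewrite -lee_fin cmu_borel//.
have pi2 : 0 < pi *+ 2 :> R by rewrite pmulrn_rgt0// pi_gt0.
rewrite muleC lee_pdivrMr// -EFinM -iT.
have mTm : measurable_fun `[0%R, (pi *+ 2)%R]%classic (fun t : measurableTypeR R => (T t)%:E).
  apply/measurable_EFinP; apply: measurable_funTS; exact: continuous_measurable_fun.
have mB0 : measurable (B `&` `[0%R, (pi *+ 2)%R]%classic : set (measurableTypeR R)).
  by apply: measurableI => //; exact: measurable_itv.
apply: (@le_trans _ _ (lebesgue_measure (B `&` `[0%R, (pi *+ 2)%R]%classic))).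
  apply: le_measure; rewrite ?inE//.
    by apply: measurableI => //; exact: measurable_itv.
  by move=> t /= []; rewrite !in_itv/= => Bt /andP[-> /ltW].
apply: (@le_trans _ _ (\int[lebesgue_measure]_(t in B `&` `[0%R, (pi *+ 2)%R]) (T t)%:E)%E).
  rewrite -[leLHS]mul1e -integral_cst//; apply: ge0_le_integral => //.
  - exact: measurable_funS mTm.
  - by move=> t [Bt _]; rewrite lee_fin.
by apply: ge0_subset_integral => // t _; rewrite lee_fin.
Qed.

End markov.

(** * Level sets of trigonometric polynomials *)

Section step.
Context {R : realType}.

Lemma bernoulli_ge (y : R) M : -1 <= y -> 1 + M%:R * y <= (1 + y) ^+ M.
Proof.
move=> y1; elim: M => [|M ih]; first by rewrite mul0r addr0 expr0.
rewrite exprS; apply: le_trans (ler_wpM2l _ ih); last by lra.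
rewrite -subr_ge0 -natr1.
have : 0 <= M%:R * (y * y) :> R by rewrite mulr_ge0// -expr2 sqr_ge0.
by lra.
Qed.

(** The witness is 1 - (1 - x^n)^M with M close to 1/(e b^n). On [0, a], Bernoulli bounds it by M
    a^n, small because n makes (a/b)^n small. On [b, 1], with y = x^n, (1 - y)^M (1 + y)^M <= 1
    while (1 + y)^M >= M y >= 1/e. *)
Lemma step_poly (a b e : R) : 0 <= a -> a < b -> b <= 1 -> 0 < e ->
  exists p : {poly R}, [/\ forall x, 0 <= x <= 1 -> 0 <= p.[x] <= 1,
    forall x, 0 <= x <= a -> p.[x] <= e &
    forall x, b <= x <= 1 -> 1 - e <= p.[x]].
Proof.
move=> a0 ab b1 e0.
have b0 : 0 < b by exact: le_lt_trans ab.
have [n nP] : exists n, (a / b) ^+ n * (e^-1 + 1) <= e.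
  have h : `|a / b| < 1 by rewrite ger0_norm ?divr_ge0 ?(ltW b0)// ltr_pdivrMr// mul1r.
  have e1 : 0 < e / (e^-1 + 1) by rewrite divr_gt0// addr_gt0// invr_gt0.
  have /cvgrPdist_lt/(_ _ e1) [n _ /(_ n (leqnn n))] := cvg_expr h.
  rewrite sub0r normrN normrX => h2; exists n.
  rewrite -ler_pdivlMr ?addr_gt0 ?invr_gt0//.
  rewrite ger0_norm ?divr_ge0 ?(ltW b0)// in h2; exact: ltW.
have bn0 : 0 < b ^+ n by rewrite exprn_gt0.
pose M := (Num.trunc (e * b ^+ n)^-1).+1.
have M1 : (e * b ^+ n)^-1 <= M%:R.
  by apply: ltW; rewrite /M; apply: truncnS_gt.
have M2 : M%:R <= (e * b ^+ n)^-1 + 1.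
  rewrite /M -natr1 lerD2r.
  by rewrite truncn_le invr_ge0 mulr_ge0 ?ltW.
exists (1 - (1 - 'X^n) ^+ M).
have E (x : R) : (1 - (1 - 'X^n) ^+ M).[x] = 1 - (1 - x ^+ n) ^+ M.
  by rewrite !(hornerE, horner_exp).
split=> x /andP[x0 x1]; rewrite E.
- have xn0 : 0 <= x ^+ n by rewrite exprn_ge0.
  have xn1 : x ^+ n <= 1 by rewrite exprn_ile1.
  have h0 : 0 <= (1 - x ^+ n) ^+ M by rewrite exprn_ge0// subr_ge0.
  have h1 : (1 - x ^+ n) ^+ M <= 1 by rewrite exprn_ile1 ?subr_ge0// gerBl.
  by apply/andP; split; lra.
- have xn1 : x ^+ n <= a ^+ n by rewrite lerXn2r// nnegrE.
  have an1 : a ^+ n <= 1 by rewrite exprn_ile1// ltW// (lt_le_trans ab).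
  have := @bernoulli_ge (- x ^+ n) M; rewrite -lerNl opprK => /(_ (le_trans xn1 an1)) h.
  suff : M%:R * x ^+ n <= e by move: h; rewrite mulrN; lra.
  apply: (le_trans _ nP).
  have xn0 : 0 <= x ^+ n by rewrite exprn_ge0.
  apply: (@le_trans _ _ (((e * b ^+ n)^-1 + 1) * a ^+ n)).
    by apply: ler_pM.
  rewrite expr_div_n -mulrA.
  have -> : ((e * b ^+ n)^-1 + 1) * a ^+ n = a ^+ n * (b ^- n * e^-1 + 1).
    by rewrite mulrC invfM [e^-1 * _]mulrC.
  apply: ler_wpM2l; first by rewrite exprn_ge0.
  rewrite mulrDr mulr1 lerD2l -[leLHS]invr1 lef_pV2 ?posrE//.
  by rewrite exprn_ile1// ltW.
- have xn1 : b ^+ n <= x ^+ n by rewrite lerXn2r// nnegrE ltW// (lt_le_trans b0).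
  have x0' : 0 <= x by apply: le_trans x0; exact: ltW.
  have xn2 : x ^+ n <= 1 by rewrite exprn_ile1.
  have xn0 : 0 <= x ^+ n by rewrite exprn_ge0.
  set y := x ^+ n in xn0 xn1 xn2 *.
  have h0 : 0 <= (1 - y) ^+ M by rewrite exprn_ge0// subr_ge0.
  have h : (1 - y) ^+ M * (1 + y) ^+ M <= 1.
    rewrite -exprMn; apply: exprn_ile1.
      by apply: mulr_ge0; lra.
    have : 0 <= y * y by apply: mulr_ge0. 
    by lra.
  have h2 : 1 + M%:R * y <= (1 + y) ^+ M by apply: bernoulli_ge; lra.
  have h3 : e^-1 <= M%:R * y.
    apply: (@le_trans _ _ (M%:R * b ^+ n)); last by apply: ler_wpM2l.
    rewrite -ler_pdivrMr//; apply: le_trans M1.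
    by rewrite invfM.
  have h4 : (1 - y) ^+ M * e^-1 <= 1.
    apply: le_trans h; apply: ler_wpM2l => //; lra.
  by rewrite ler_pdivrMr// mul1r in h4; lra.
Qed.

Definition is_trig (G : R -> R[i]) := exists D c, trigm D G c.

Lemma is_trig_cst c : is_trig (fun=> c).
Proof. by exists 0%N, c; exact: trigm_cst. Qed.

Lemma is_trigD G H : is_trig G -> is_trig H -> is_trig (G \+ H).
Proof.
move=> [D [c Gc]] [E [d Hd]]; exists (D + E)%N, (c + d); apply: trigmD.
  by apply: trigm_le Gc; exact: leq_addr.
by apply: trigm_le Hd; exact: leq_addl.
Qed.

Lemma is_trigM G H : is_trig G -> is_trig H -> is_trig (G \* H).
Proof.
by move=> [D [c Gc]] [E [d Hd]]; have [b] := trigmM Gc Hd; exists (D + E)%N, b.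
Qed.

Lemma is_trig_conj G : is_trig G -> is_trig (fun t => conjc (G t)).
Proof. by move=> [D [c Gc]]; exists D, (conjc c); exact: trigm_conj. Qed.

Lemma eq_is_trig G H : G =1 H -> is_trig G -> is_trig H.
Proof. by move=> GH [D [c Gc]]; exists D, c; exact: eq_trigm Gc. Qed.

Lemma is_trigB G H : is_trig G -> is_trig H -> is_trig (G \- H).
Proof.
move=> tG tH; apply: (@eq_is_trig (G \+ (fun=> -1) \* H)).
  by move=> t /=; rewrite mulN1r.
by apply: is_trigD => //; apply: is_trigM => //; exact: is_trig_cst.
Qed.

Lemma is_trig_horner (p : {poly R[i]}) : is_trig (fun t => p.[expi t]).
Proof. by exists (size p), p`_0; exact: trigm_horner. Qed.

Lemma is_trig_poly (T : R -> R) (q : {poly R}) : is_trig (fun t => (T t)%:C) ->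
  is_trig (fun t => (q.[T t])%:C).
Proof.
move=> tT; elim/poly_ind: q => [|q c ih].
  by apply: (@eq_is_trig (fun=> 0)) (is_trig_cst _) => t; rewrite horner0.
apply: (@eq_is_trig (((fun t => (q.[T t])%:C) \* (fun t => (T t)%:C)) \+ (fun=> c%:C))).
  by move=> t /=; rewrite !hornerE rmorphD rmorphM.
by apply: is_trigD; [exact: is_trigM|exact: is_trig_cst].
Qed.

Lemma is_trig_sqr G : is_trig G -> is_trig (fun t => (nm (G t) ^+ 2)%:C).
Proof.
move=> tG; apply: (@eq_is_trig (G \* (fun t => conjc (G t)))).
  by move=> t /=; rewrite nm_sqr.
by apply: is_trigM => //; exact: is_trig_conj.
Qed.

Lemma nm_horner_le (p : {poly R[i]}) t : nm p.[expi t] <= \sum_(i < size p) nm p`_i.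
Proof.
rewrite horner_coef; apply: le_trans (nm_sum _ _ _) _; apply: ler_sum => i _.
by rewrite nmM nmX nm_expi expr1n mulr1.
Qed.

Lemma is_trig_bound G : is_trig G -> exists2 B : R, 1 <= B & forall t, nm (G t) <= B.
Proof.
move=> [D [c [g [_ Gg _]]]]; exists (1 + \sum_(i < size g) nm g`_i).
  by rewrite lerDl sumr_ge0// => i _; exact: nm_ge0.
move=> t; apply: ler_wpDl => //; apply: le_trans (nm_horner_le _ t).
by rewrite -Gg nmM nmX nm_expi expr1n mulr1.
Qed.

Lemma measurable_trig_gt G d : is_trig G ->
  measurable ([set t | d < nm (G t)] : set (measurableTypeR R)).
Proof.
move=> tG; have [D [c h]] := is_trig_sqr tG.
have [cT _] := integral_trigm h.
have [d0|d0] := ltP d 0.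
  rewrite (_ : [set _ | _] = setT); first exact: measurableT.
  by apply/seteqP; split=> // t _ /=; exact: lt_le_trans (nm_ge0 _).
rewrite (_ : [set _ | _] = setT `&` (fun t => nm (G t) ^+ 2) @^-1` `]d ^+ 2, +oo[%classic); last first.
  rewrite setTI; apply/seteqP; split=> t /=; rewrite in_itv/= andbT;
  by rewrite ltr_pXn2r ?nnegrE ?nm_ge0.
by apply: (continuous_measurable_fun cT) => //; exact: measurable_itv.
Qed.

(** Markov's inequality for 1 + e - T, which is at least 1 off A. *)
Lemma mean_le_cmu D (T : R -> R) c (A : set R) e : trigm D (fun t => (T t)%:C) c ->
  measurable (A : set (measurableTypeR R)) -> 0 <= e ->
  (forall t, T t <= 1) -> (forall t, ~ A t -> T t <= e) -> Re c <= cmu A + e.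
Proof.
move=> tT mA e0 T1 Te.
have h : trigm D (fun t => (1 + e - T t)%:C) ((1 + e)%:C + (-1) * c).
  apply: (@eq_trigm _ _ ((fun=> (1 + e)%:C) \+ (fun t => -1 * (T t)%:C))).
    by move=> t /=; rewrite mulN1r rmorphB.
  by apply: trigmD; [exact: trigm_le (trigm_cst _)|exact: trigmZ].
have := @trigm_markov _ _ _ _ (~` A) h.
rewrite mulN1r ReD /= (_ : Re (- c) = - Re c); last by case: c {tT h}.
have := cmuC mA => AC /(_ _ _).
suff : (forall t, 0 <= 1 + e - T t) /\ (forall t, (~` A) t -> 1 <= 1 + e - T t).
  by move=> [h1 h2] /(_ h1 h2); lra.
by split=> t; [have := T1 t|move=> /Te]; lra.
Qed.

(** T is a step polynomial of |G|^2 / B^2, with B above |G| and d1. It acts as an indicator of the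
    set where |G| is large, and its mean, being a coefficient, passes through dilations and
    products. *)
Lemma trig_step G (d0 d1 e : R) : is_trig G -> 0 <= d0 -> d0 < d1 -> 0 < e ->
  exists T : R -> R, exists D c, [/\ trigm D (fun t => (T t)%:C) c,
    forall t, 0 <= T t <= 1, forall t, nm (G t) <= d0 -> T t <= e,
    forall t, d1 <= nm (G t) -> 1 - e <= T t &
    Re c <= cmu [set t | d0 < nm (G t)] + e].
Proof.
move=> tG d00 d01 e0; have [B0 B01 GB0] := is_trig_bound tG.
have d10 : 0 < d1 by exact: le_lt_trans d01.
pose B := B0 + d1.
have B1 : 0 < B by rewrite addr_gt0// (lt_le_trans ltr01).
have d1B : d1 <= B by rewrite lerDr (le_trans ler01).
have GB t : nm (G t) <= B by rewrite (le_trans (GB0 t))// lerDl ltW.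
have sq x y : 0 <= x -> 0 <= y -> (x / B) ^+ 2 <= (y / B) ^+ 2 = (x <= y).
  by move=> x0 y0; rewrite ler_pXn2r ?nnegrE ?divr_ge0 ?(ltW B1)// ler_pM2r ?invr_gt0.
have [p [p1 p2 p3]] : exists p : {poly R}, [/\ forall x, 0 <= x <= 1 -> 0 <= p.[x] <= 1,
    forall x, 0 <= x <= (d0 / B) ^+ 2 -> p.[x] <= e &
    forall x, (d1 / B) ^+ 2 <= x <= 1 -> 1 - e <= p.[x]].
  apply: step_poly => //.
  - exact: sqr_ge0.
  - by rewrite ltr_pXn2r ?nnegrE ?divr_ge0 ?(ltW B1) ?(ltW d10)// ltr_pM2r ?invr_gt0.
  - by rewrite exprn_ile1// ?divr_ge0 ?(ltW B1) ?(ltW d10)// ler_pdivrMr// mul1r.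
pose T t := p.[(nm (G t) / B) ^+ 2].
have [D [c Tc]] : is_trig (fun t => (T t)%:C).
  apply: is_trig_poly.
  apply: (@eq_is_trig ((fun t => (nm (G t) ^+ 2)%:C) \* (fun=> (B^-1 ^+ 2)%:C))).
    by move=> t /=; rewrite -rmorphM -exprMn.
  by apply: is_trigM; [exact: is_trig_sqr|exact: is_trig_cst].
have x01 t : 0 <= (nm (G t) / B) ^+ 2 <= 1.
  rewrite sqr_ge0/= exprn_ile1//; first by rewrite divr_ge0 ?nm_ge0 ?(ltW B1).
  by rewrite ler_pdivrMr// mul1r.
have T01 t : 0 <= T t <= 1 by exact: p1.
have Te t : nm (G t) <= d0 -> T t <= e.
  by move=> h; apply: p2; rewrite sqr_ge0/= sq ?nm_ge0.
exists T, D, c; split=> //.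
- by move=> t h; apply: p3; rewrite sq ?nm_ge0 ?(ltW d10)// h; have /andP[] := x01 t.
- apply: mean_le_cmu Tc _ (ltW e0) _ _.
  + exact: measurable_trig_gt.
  + by move=> t; have /andP[] := T01 t.
  + by move=> t /negP; rewrite -leNgt; exact: Te.
Qed.

(** Dilation preserves measure. Instead of a change of variables, T(nt) has the mean of T by
    [trigm_dil]; the slack from d0 to d1 pays for T being only close to an indicator. *)
Lemma cmu_dilation G (d0 d1 : R) n : is_trig G -> 0 <= d0 -> d0 < d1 -> (0 < n)%N ->
  cmu [set t | d1 < nm (G (n%:R * t))] <= cmu [set t | d0 < nm (G t)].
Proof.
move=> tG d00 d01 n0; apply/ler_addgt0Pr => e e0.
have e2 : 0 < e / 2 by rewrite divr_gt0.
have [T [D [c [Tc T01 T0 T1 cle]]]] := trig_step tG d00 d01 e2.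
have TN : trigm (n * D) (fun t => (T (n%:R * t) + e / 2)%:C) (c + (e / 2)%:C).
  apply: (@eq_trigm _ _ ((fun t => 1 * (T (n%:R * t))%:C) \+ fun=> (e / 2)%:C)).
    by move=> t /=; rewrite mul1r rmorphD.
  apply: trigmD; last exact: trigm_le (trigm_cst _).
  rewrite -[c]mul1r -[(n * D)%N]add0n.
  by apply: (@trigm_dil _ 0 D n (fun=> 1) (fun t => (T t)%:C)) => //; exact: trigm_cst.
have := @trigm_markov _ _ _ _ [set t | d1 < nm (G (n%:R * t))] TN.
rewrite ReD /= => h; apply: (le_trans (h _ _)).
- by move=> t; rewrite addr_ge0 ?(ltW e2)//; have /andP[] := T01 (n%:R * t).
- by move=> t /ltW /T1; lra.
- by move: cle; lra.
Qed.

End step.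

(** * A factor with small coefficients that is often small *)

Section lacunary.
Context {R : realType}.

Definition rmean (T : R -> R) (mu : R) :=
  exists D, trigm D (fun t => (T t)%:C) mu%:C.

Lemma eq_rmean S T mu : S =1 T -> rmean S mu -> rmean T mu.
Proof. by move=> ST [D h]; exists D; apply: eq_trigm h => t; rewrite ST. Qed.

Lemma rmean_cst a : rmean (fun=> a) a.
Proof. by exists 0%N; exact: trigm_cst. Qed.

Lemma rmeanD S T a b : rmean S a -> rmean T b -> rmean (fun t => S t + T t) (a + b).
Proof.
move=> [D hD] [E hE]; exists (D + E)%N; rewrite rmorphD.
apply: (@eq_trigm _ _ ((fun t => (S t)%:C) \+ (fun t => (T t)%:C))).
  by move=> t /=; rewrite rmorphD.
apply: trigmD; first by apply: trigm_le hD; exact: leq_addr.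
by apply: trigm_le hE; exact: leq_addl.
Qed.

Lemma rmeanZ T a k : rmean T a -> rmean (fun t => k * T t) (k * a).
Proof.
move=> [D hD]; exists D; rewrite rmorphM.
by apply: eq_trigm (trigmZ k%:C hD) => t; rewrite rmorphM.
Qed.

Lemma rmean_dil D q S T a b : (D < q)%N -> trigm D (fun t => (S t)%:C) a%:C ->
  rmean T b -> rmean (fun t => S t * T (q%:R * t)) (a * b).
Proof.
move=> Dq hS [E hT]; exists (D + q * E)%N; rewrite rmorphM.
by apply: eq_trigm (trigm_dil Dq hS hT) => t; rewrite rmorphM.
Qed.

Let trigm_cos_dil n : (0 < n)%N ->
  trigm n (fun t : R => (cos (n%:R * t))%:C) (0 : R)%:C.
Proof.
move=> n0.
have h : trigm 1 (fun t : R => (cos t)%:C) 0.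
  exists (2^-1 *: ('X^2 + 1)); split.
  - rewrite (leq_trans (size_scale_leq _ _))// (leq_trans (size_polyD _ _))//.
    by rewrite size_polyXn size_poly1.
  - move=> t; rewrite !(hornerE, horner_exp) expr1.
    have -> : (cos t)%:C = 2^-1 * (expi t + conjc (expi t)) :> R[i].
      rewrite addcJ mulrA mulVf ?mul1r//; by rewrite pnatr_eq0.
    by rewrite conjc_expi -mulrA mulrDl mulVf ?expi_neq0// expr2.
  - by rewrite coefZ coefD coefXn coef1 addr0 mulr0.
have := @trigm_dil _ 0 1 n (fun=> 1) _ _ _ n0 (trigm_cst 1) h.
rewrite mulr0 add0n muln1; apply: eq_trigm => t; by rewrite mul1r.
Qed.

Let trigm_cos1 : trigm 1 (fun t : R => (cos t)%:C) (0 : R)%:C.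
Proof. by apply: eq_trigm (trigm_cos_dil (ltn0Sn 0)) => t; rewrite mul1r. Qed.

Let trigm_real_lin D (S T : R -> R) (a b k l : R) :
  trigm D (fun t => (S t)%:C) a%:C -> trigm D (fun t => (T t)%:C) b%:C ->
  trigm D (fun t => (k * S t + l * T t)%:C) (k * a + l * b)%:C.
Proof.
move=> hS hT; rewrite rmorphD !rmorphM.
apply: eq_trigm (trigmD (trigmZ k%:C hS) (trigmZ l%:C hT)) => t /=.
by rewrite rmorphD !rmorphM.
Qed.

Let cos_2x (t : R) : cos (2%:R * t) = 2 * cos t ^+ 2 - 1.
Proof. by rewrite mulr_natl cos_mulr2n mulr_natl. Qed.

(** Here and for the next two powers: power reduction to cosines of multiples of t, whose means are
    known. *)
Let trigm_cos2 : trigm 2 (fun t : R => (cos t ^+ 2)%:C) (2^-1 : R)%:C.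
Proof.
have h1 : trigm 2 (fun t : R => (1 : R)%:C) (1 : R)%:C.
  exact: trigm_le (trigm_cst _).
have := trigm_real_lin 2^-1 2^-1 (trigm_cos_dil (ltn0Sn 1)) h1.
rewrite mulr0 add0r mulr1; apply: eq_trigm => t; congr (_%:C).
by rewrite cos_2x; field.
Qed.

Let trigm_cos3 : trigm 3 (fun t : R => (cos t ^+ 3)%:C) (0 : R)%:C.
Proof.
have h1 : trigm 3 (fun t : R => (cos t)%:C) (0 : R)%:C.
  exact: trigm_le trigm_cos1.
have := trigm_real_lin 4^-1 (3 / 4) (trigm_cos_dil (ltn0Sn 2)) h1.
rewrite !mulr0 addr0; apply: eq_trigm => t; congr (_%:C).
have -> : 3%:R * t = 2%:R * t + t by ring.
rewrite cosD cos_2x [2%:R * t]mulr_natl sin_mulr2n.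
have := cos2Dsin2 t; set c := cos t; set s := sin t => h.
have -> : (c * s *+ 2) * s = 2 * c * (1 - c ^+ 2).
  have -> : 1 - c ^+ 2 = s ^+ 2 by rewrite -h addrC addKr.
  by rewrite -mulr_natl; ring.
by field.
Qed.

Let trigm_cos4 : trigm 4 (fun t : R => (cos t ^+ 4)%:C) (3 / 8 : R)%:C.
Proof.
have h0 : trigm 4 (fun t : R => (1 : R)%:C) (1 : R)%:C.
  exact: trigm_le (trigm_cst _).
have h1 : trigm 4 (fun t : R => (cos (2%:R * t))%:C) (0 : R)%:C.
  exact: trigm_le (trigm_cos_dil (ltn0Sn 1)).
have := trigm_real_lin 1 (3 / 8) (trigm_real_lin 8^-1 2^-1 (trigm_cos_dil (ltn0Sn 3)) h1) h0.
rewrite !(mulr0, addr0, add0r, mulr1); apply: eq_trigm => t; congr (_%:C).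
have -> : 4%:R * t = 2%:R * (2%:R * t) by ring.
by rewrite !cos_2x; field.
Qed.

(** The lacunary sum of the cos(q^j t), j < N. Peeling off the lowest frequency leaves a dilate by
    q, the form that [rmean_dil] takes. *)
Fixpoint lacsum (q N : nat) (t : R) : R :=
  if N is N'.+1 then cos t + lacsum q N' (q%:R * t) else 0.

(** Binomial expansion of (cos t + S(qt))^k: as q > 4 >= k every mean factors, so the moments are
    those of N independent cosines. *)
Lemma lacsum_moments q N : (4 < q)%N ->
  [/\ rmean (lacsum q N) 0, rmean (fun t => lacsum q N t ^+ 2) (N%:R / 2),
      rmean (fun t => lacsum q N t ^+ 3) 0 &
      rmean (fun t => lacsum q N t ^+ 4) (3 / 4 * N%:R ^+ 2 - 3 / 8 * N%:R)].
Proof.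
move=> q4; have q0 : (0 < q)%N by lia.
have q1 : (1 < q)%N by lia.
have q2 : (2 < q)%N by lia.
have q3 : (3 < q)%N by lia.
elim: N => [|N [ih1 ih2 ih3 ih4]].
  split; [have := rmean_cst 0|have := rmean_cst 0|have := rmean_cst 0|have := rmean_cst 0].
  - by apply: eq_rmean.
  - by rewrite mul0r; apply: eq_rmean => t /=; rewrite expr0n.
  - by apply: eq_rmean => t /=; rewrite expr0n.
  - have -> : 3 / 4 * 0%:R ^+ 2 - 3 / 8 * 0%:R = 0 :> R by ring.
    by apply: eq_rmean => t /=; rewrite expr0n.
have h0 : rmean (fun=> 1 : R) 1 by exact: rmean_cst.
have t0 : trigm 0 (fun t : R => (1 : R)%:C) (1 : R)%:C by exact: trigm_cst.
split.
- have := rmeanD (rmean_dil q1 trigm_cos1 h0) (rmean_dil q0 t0 ih1).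
  rewrite !mulr0 mul0r addr0; apply: eq_rmean => t /=; ring.
- have := rmeanD (rmean_dil q2 trigm_cos2 h0)
    (rmeanD (rmeanZ 2 (rmean_dil q1 trigm_cos1 ih1)) (rmean_dil q0 t0 ih2)).
  have -> : 2^-1 * 1 + (2 * (0 * 0) + 1 * (N%:R / 2)) = N.+1%:R / 2 :> R.
    by rewrite -natr1; field.
  apply: eq_rmean => t /=; ring.
- have := rmeanD (rmean_dil q3 trigm_cos3 h0)
    (rmeanD (rmeanZ 3 (rmean_dil q2 trigm_cos2 ih1))
     (rmeanD (rmeanZ 3 (rmean_dil q1 trigm_cos1 ih2)) (rmean_dil q0 t0 ih3))).
  rewrite !(mulr0, mul0r, addr0); apply: eq_rmean => t /=; ring.
- have := rmeanD (rmean_dil q4 trigm_cos4 h0)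
    (rmeanD (rmeanZ 4 (rmean_dil q3 trigm_cos3 ih1))
     (rmeanD (rmeanZ 6 (rmean_dil q2 trigm_cos2 ih2))
      (rmeanD (rmeanZ 4 (rmean_dil q1 trigm_cos1 ih3)) (rmean_dil q0 t0 ih4)))).
  set u := (X in rmean _ X -> _).
  have -> : u = 3 / 4 * N.+1%:R ^+ 2 - 3 / 8 * N.+1%:R.
    by rewrite /u -natr1; field.
  apply: eq_rmean => t /=; ring.
Qed.

(** As [size p] <= q, the shifted copies of p do not overlap: only the digits l mod q and l div q
    contribute. *)
Lemma coefM_compXn (p r : {poly R[i]}) q l : (size p <= q)%N -> (0 < q)%N ->
  (p * (r \Po 'X^q))`_l = p`_(l %% q) * r`_(l %/ q).
Proof.
move=> sp q0; rewrite coefM.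
have ml : (l %% q < l.+1)%N by rewrite ltnS leq_mod.
rewrite (bigD1 (Ordinal ml)) //= [X in _ + X]big1 ?addr0 => [|i il].
  have e : (l - l %% q = l %/ q * q)%N by rewrite {1}(divn_eq l q) addnK.
  by rewrite coef_comp_poly_Xn// e dvdn_mull// mulnK.
have [si|si] := leqP (size p) i; first by rewrite nth_default ?mul0r.
rewrite coef_comp_poly_Xn//; case: ifP => [h|_]; last by rewrite mulr0.
case/negP: il; apply/eqP/val_inj => /=.
have iq : (i < q)%N by exact: leq_trans si sp.
have il : (i <= l)%N by rewrite -ltnS.
move: (nat_of_ord i) il h iq => j jl h jq.
by rewrite -(subnK jl) -modnDml (eqP h) add0n modn_small.
Qed.

(** A polynomial substitute for exp(a X), of degree at most m; [lacprod] multiplies its values at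
    the X^(q^j), j < N. *)
Let base (m : nat) (a : R) : {poly R[i]} := (1 + (a / m%:R)%:C *: 'X) ^+ m.

Fixpoint lacprod (m q : nat) (a : R) N : {poly R[i]} :=
  if N is N'.+1 then base m a * (lacprod m q a N' \Po 'X^q) else 1.

(** The binomial bound C(k, l) b^l <= (k b)^l, by Pascal's recursion. *)
Let pow_coef (b : R) k l : 0 <= b ->
  nm ((1 + b%:C *: 'X) ^+ k : {poly R[i]})`_l <= (k%:R * b) ^+ l.
Proof.
move=> b0; elim: k l => [|k ih] l.
  rewrite expr0 coef1; case: l => [|l] /=; first by rewrite nm1 expr0.
  by rewrite nm0 mul0r expr0n.
rewrite exprS mulrDl mul1r coefD -scalerAl coefZ coefXM.
apply: le_trans (nmD _ _) _; rewrite nmM nm_real ger0_norm//.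
case: l => [|l] /=; first by rewrite nm0 mulr0 addr0 (le_trans (ih 0%N)).
apply: (@le_trans _ _ ((k%:R * b) ^+ l * (k.+1%:R * b))).
  rewrite -natr1 mulrDl mul1r mulrDr -exprSr; apply: lerD; first exact: ih.
  by rewrite mulrC; apply: ler_wpM2r.
rewrite exprSr; apply: ler_wpM2r; first by rewrite mulr_ge0.
by rewrite lerXn2r ?nnegrE ?mulr_ge0// ler_wpM2r// ler_nat.
Qed.

(** Since m < q, the coefficient of index l < q^N is the product of the coefficients of [base] at
    the base-q digits of l. A digit 0 contributes 1, any other at most a. *)
Lemma lacprod_coef m q (a : R) N l : (0 < m)%N -> (m < q)%N -> 0 <= a <= 1 ->
  [/\ (lacprod m q a N)`_0 = 1, nm (lacprod m q a N)`_l <= 1 &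
      (0 < l)%N -> nm (lacprod m q a N)`_l <= a].
Proof.
move=> m0 mq /andP[a0 a1]; have q0 : (0 < q)%N by lia.
have mb : m%:R * (a / m%:R) = a by rewrite mulrC divfK// pnatr_eq0 -lt0n.
have b0 : 0 <= a / m%:R by rewrite divr_ge0.
have sb : (size (base m a) <= q)%N.
  apply: leq_trans mq; rewrite /base; apply: leq_trans (size_poly_exp_leq _ _) _.
  rewrite ltnS -[leqRHS]mul1n leq_mul2r; apply/orP; right.
  have : (size ((1 + (a / m%:R)%:C *: 'X)%R : {poly R[i]}) <= 2)%N.
    rewrite (leq_trans (size_polyD _ _))// geq_max size_poly1/=.
    by rewrite (leq_trans (size_scale_leq _ _))// size_polyX.
  by lia.
have bc k : nm (base m a)`_k <= a ^+ k by rewrite -[X in _ <= X ^+ _]mb; exact: pow_coef.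
have base0 : (base m a)`_0 = 1.
  by rewrite -horner_coef0 /base horner_exp !hornerE ?mulr0 ?addr0 expr1n.
elim: N l => [|N ih] l /=.
  by rewrite !coef1; split=> //; case: l => [|l]; rewrite ?nm1 ?nm0.
rewrite !coefM_compXn// mod0n div0n.
have [F0 F1 F2] := ih (l %/ q)%N.
have B1 k : nm (base m a)`_k <= 1 by rewrite (le_trans (bc k))// exprn_ile1.
split; first by rewrite F0 base0 mulr1.
  by rewrite nmM -[leRHS]mulr1 ler_pM ?nm_ge0.
move=> l0; rewrite nmM; case: (posnP (l %% q)%N) => h.
  rewrite h base0 nm1 mul1r; apply: F2; rewrite divn_gt0//.
  by apply: dvdn_leq => //; rewrite /dvdn h.
rewrite -[leRHS]mulr1 ler_pM ?nm_ge0//; apply: (le_trans (bc _)).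
case: (l %% q)%N h => // k _; rewrite exprS -[leRHS]mulr1 ler_wpM2l//.
exact: exprn_ile1.
Qed.

(** On the circle |1 + bz|^2 = 1 + 2b cos t + b^2 <= exp(2b cos t + b^2); take b = a/m and the power
    m. *)
Lemma lacprod_bound m q (a : R) N t : (0 < m)%N ->
  nm (lacprod m q a N).[expi t] ^+ 2 <=
  expR (2 * a * lacsum q N t + N%:R * (a ^+ 2 / m%:R)).
Proof.
move=> m0; elim: N t => [|N ih] t /=.
  by rewrite hornerC nm1 expr1n mulr0 mul0r addr0 expR0.
rewrite hornerM horner_comp hornerXn -expiMn nmM exprMn.
have -> : 2 * a * (cos t + lacsum q N (q%:R * t)) + N.+1%:R * (a ^+ 2 / m%:R) =
  (2 * a * cos t + a ^+ 2 / m%:R) +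
  (2 * a * lacsum q N (q%:R * t) + N%:R * (a ^+ 2 / m%:R)).
  by rewrite -natr1; ring.
rewrite expRD; apply: ler_pM; rewrite ?sqr_ge0//.
rewrite /base horner_exp nmX exprAC.
have mR : m%:R != 0 :> R by rewrite pnatr_eq0 -lt0n.
have -> : 2 * a * cos t + a ^+ 2 / m%:R =
    m%:R * (2 * (a / m%:R) * cos t + (a / m%:R) ^+ 2) by field.
rewrite expRM_natl; apply: lerXn2r; rewrite ?nnegrE ?sqr_ge0 ?expR_ge0//.
set b := a / m%:R; rewrite hornerD hornerZ hornerX hornerC nm_sqrE.
have -> : Re (1 + b%:C * expi t) ^+ 2 + Im (1 + b%:C * expi t) ^+ 2 =
   1 + (2 * b * cos t + b ^+ 2).
  rewrite /expi /= !mul0r subr0 addr0 add0r.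
  have := cos2Dsin2 t; set c := cos t; set d := sin t => h.
  rewrite -[b ^+ 2]mulr1 -[X in b ^+ 2 * X]h; ring.
exact: expR_ge1Dx.
Qed.

(** A universal lower bound for the proportion of the circle where the factor below is small. *)
Definition gain : R := 50^-1.

(** F is [lacprod] with N = m = K^2, and y = S/K is the normalized cosine sum, with first four
    moments 0, 1/2, 0 and almost 3/4. The quartic T in y is nonnegative, at least 1 for y >= -1/4,
    and of mean at most 1 - 7/248. Where y < -1/4, |F|^2 <= exp(2aKy + a^2) is at most s^2 for K
    large. *)
Lemma contracting_factor (a0 s : R) : 0 < a0 -> 0 < s ->
  exists F : {poly R[i]}, exists T : R -> R, exists mu,
  [/\ F`_0 = 1 /\ (forall l, (0 < l)%N -> nm F`_l <= a0),
      rmean T mu, mu <= 1 - gain, forall t, 0 <= T t &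
      forall t, s < nm F.[expi t] -> 1 <= T t].
Proof.
move=> a00 s0; pose a := Num.min a0 1.
have a_gt0 : 0 < a by rewrite lt_min a00 ltr01.
have a1 : a <= 1 by rewrite ge_min lexx orbT.
(* Once aK >= H, y < -1/4 gives 2aKy + a^2 <= 1 - H/2 = ln(s^2). *)
pose H := 2 * (1 - ln (s ^+ 2)).
pose K := (Num.trunc (H / a)).+1.
have HK : H <= a * K%:R.
  by rewrite mulrC -ler_pdivrMr// ltW// truncnS_gt.
have K0 : 0 < K%:R :> R by rewrite ltr0n.
pose m := (K ^ 2)%N; pose q := (m + 5)%N.
have m0 : (0 < m)%N by rewrite expn_gt0.
have mR : m%:R = K%:R ^+ 2 :> R by rewrite natrX.
have q4 : (4 < q)%N by rewrite /q; lia.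
have mq : (m < q)%N by rewrite /q; lia.
have a01 : 0 <= a <= 1 by rewrite (ltW a_gt0).
pose N := (K ^ 2)%N.
have NR : N%:R = K%:R ^+ 2 :> R by rewrite natrX.
pose y t := lacsum q N t / K%:R.
pose T t := 1 + 31^-1 * ((y t + 4^-1) * (y t + 3) * (y t - 1) ^+ 2).
have [M1 M2 M3 M4] := lacsum_moments N q4.
exists (lacprod m q a N), T.
exists (1 + 31^-1 * (K%:R ^- 4 * (3 / 4 * N%:R ^+ 2 - 3 / 8 * N%:R) +
  (5 / 4 * K%:R ^- 3 * 0 + (- (19 / 4) * K%:R ^- 2 * (N%:R / 2) +
   (7 / 4 * K%:R^-1 * 0 + 3 / 4))))).
have Kn0 : K%:R != 0 :> R by rewrite gt_eqF.
split.
- split=> [|l l0]; first by have [] := lacprod_coef N 0 m0 mq a01.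
  have [_ _ /(_ l0) h] := lacprod_coef N l m0 mq a01.
  by apply: le_trans h _; rewrite ge_min lexx.
- have := rmeanD (rmean_cst 1) (rmeanZ 31^-1 (rmeanD (rmeanZ (K%:R ^- 4) M4)
   (rmeanD (rmeanZ (5 / 4 * K%:R ^- 3) M3) (rmeanD (rmeanZ (- (19 / 4) * K%:R ^- 2) M2)
    (rmeanD (rmeanZ (7 / 4 * K%:R^-1) M1) (rmean_cst (3 / 4))))))).
  apply: eq_rmean => t; rewrite /T /y; by field.
- rewrite NR /gain.
  have -> : K%:R ^- 4 * (3 / 4 * (K%:R ^+ 2) ^+ 2 - 3 / 8 * K%:R ^+ 2) =
    3 / 4 - 3 / 8 * K%:R ^- 2 :> R by field.
  have -> : - (19 / 4) * K%:R ^- 2 * (K%:R ^+ 2 / 2) = - (19 / 8) :> R by field.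
  have : 0 <= K%:R ^- 2 :> R by rewrite invr_ge0 sqr_ge0.
  lra.
- move=> t; rewrite /T; set z := y t.
  have h1 : 0 <= (z ^+ 2 + 5 / 8 * z - 3) ^+ 2 by exact: sqr_ge0.
  have h2 : 0 <= (z + 16 / 5) ^+ 2 by exact: sqr_ge0.
  (* Completing squares bounds the quartic below by -341/20 > -31, whence T >= 0. *)
  have -> : (z + 4^-1) * (z + 3) * (z - 1) ^+ 2 =
    (z ^+ 2 + 5 / 8 * z - 3) ^+ 2 + 55 / 64 * (z + 16 / 5) ^+ 2 - 341 / 20 by field.
  lra.
- move=> t st; have [h|h] := leP (- 4^-1) (y t).
    rewrite /T lerDl; apply: mulr_ge0; first by rewrite invr_ge0.
    by rewrite mulr_ge0 ?sqr_ge0// mulr_ge0//; lra.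
  have := lacprod_bound q a N t m0; rewrite leNgt => /negP[].
  apply: (@le_lt_trans _ _ (s ^+ 2)); last first.
    by rewrite ltr_pXn2r ?nnegrE ?nm_ge0 ?(ltW s0).
  have -> : s ^+ 2 = expR (ln (s ^+ 2)) by rewrite lnK// posrE exprn_gt0.
  rewrite ler_expR.
  have -> : lacsum q N t = y t * K%:R by rewrite /y divfK.
  have -> : N%:R * (a ^+ 2 / m%:R) = a ^+ 2 by rewrite mulrC divfK// pnatr_eq0 -lt0n.
  have : a ^+ 2 <= 1 by rewrite exprn_ile1// ltW.
  have : (a * K%:R) * y t <= (a * K%:R) * (- 4^-1).
    by rewrite ler_wpM2l ?(ltW h)// mulr_ge0 ?ltW.
  move: HK; rewrite /H; lra.
Qed.

End lacunary.

(** * Analytic approximation of the constant 1 *)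

Section reduction.
Context {R : realType}.
Implicit Types p g h u A : {poly R[i]}.

Lemma cmu0 : cmu (set0 : set R) = 0.
Proof.
have := @cmuC R set0 measurable0; rewrite setC0 cmuT => h.
by apply: (addIr 1); rewrite h add0r.
Qed.

Lemma cmu_nil (A : set R) : (forall t, ~ A t) -> cmu A = 0.
Proof. by move=> h; rewrite (_ : A = set0) ?cmu0// -subset0 => t /h. Qed.

Lemma trigm_mean_ge0 D (T : R -> R) c : trigm D (fun t => (T t)%:C) c ->
  (forall t, 0 <= T t) -> 0 <= Re c.
Proof. by move=> hT T0; rewrite -cmu0; apply: (trigm_markov hT T0). Qed.

(** The l^1 norm of the coefficients, which bounds all truncations on the circle. *)
Definition coefsum p : R := \sum_(i < size p) nm p`_i.

Lemma coefsum_ge0 p : 0 <= coefsum p.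
Proof. by apply: sumr_ge0 => i _; exact: nm_ge0. Qed.

Lemma coefsum_take k p (x : R[i]) : nm x = 1 -> nm (take_poly k p).[x] <= coefsum p.
Proof.
move=> x1; have st : (size (take_poly k p) <= size p)%N.
  by apply/leq_sizeP => j hj; rewrite coef_take_poly nth_default//; case: ifP.
rewrite (horner_coef_wide _ st); apply: le_trans (nm_sum _ _ _) _.
apply: ler_sum => i _; rewrite nmM nmX x1 expr1n mulr1 coef_take_poly.
by case: ifP => // _; rewrite nm0 nm_ge0.
Qed.

Lemma coefsum_horner p (x : R[i]) : nm x = 1 -> nm p.[x] <= coefsum p.
Proof. by move=> x1; rewrite -{1}(take_poly_id (leqnn (size p))) coefsum_take. Qed.

(** Cutting g(x) h(x^n) at k = ln + r keeps l full copies of g and cuts the next copy at r. *)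
Lemma take_poly_compXn g h n k : (0 < n)%N -> (size g <= n)%N ->
  take_poly k (g * (h \Po 'X^n)) =
  g * (take_poly (k %/ n) h \Po 'X^n) +
  h`_(k %/ n) *: (take_poly (k %% n) g * 'X^(k %/ n * n)).
Proof.
move=> n0 sg; apply/polyP => i.
rewrite coef_take_poly coefD coefZ coefMXn !coefM_compXn// !coef_take_poly.
set l := (k %/ n)%N; have kE := divn_eq k n; rewrite -/l in kE.
have rn : (k %% n < n)%N by rewrite ltn_mod.
have iE := divn_eq i n; have sn : (i %% n < n)%N by rewrite ltn_mod.
have [il|il] := ltnP i (l * n).
  rewrite ltn_divLR// il mulr0 addr0 ifT//.
  by rewrite kE (leq_trans il)// leq_addr.
have -> : (i %/ n < l)%N = false by rewrite ltn_divLR// ltnNge il.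
rewrite mulr0 add0r.
rewrite ltn_subLR// -kE; case: ifP => [ik|_]; last by rewrite mulr0.
have e : (i %/ n = l)%N.
  apply/eqP; rewrite eqn_leq leq_divRL// il andbT -ltnS ltn_divLR//.
  by rewrite mulSn addnC; apply: leq_trans ik _; rewrite {1}kE leq_add2l ltnW.
by rewrite {3}iE e addKn mulrC.
Qed.

(** The l^2 norm of the coefficients of g is at most B and truncation does not increase it;
    Chebyshev's inequality concludes. *)
Lemma parseval_take g (B e : R) k : (forall t, nm g.[expi t] <= B) -> 0 < e ->
  cmu [set t | e < nm (take_poly k g).[expi t]] <= (B / e) ^+ 2.
Proof.
move=> gB e0.
have sqB : \sum_(i < size g) nm g`_i ^+ 2 <= B ^+ 2.
  have h : trigm (size g) (fun t => (B ^+ 2 - nm g.[expi t] ^+ 2)%:C)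
     ((B ^+ 2)%:C + (-1) * (\sum_(i < size g) nm g`_i ^+ 2)%:C).
    apply: (@eq_trigm _ _ ((fun=> (B ^+ 2)%:C) \+ (fun t => -1 * (nm g.[expi t] ^+ 2)%:C))).
      by move=> t /=; rewrite mulN1r rmorphB.
    apply: trigmD; first exact: trigm_le (trigm_cst _).
    by apply: trigmZ; exact: trigm_sqr_horner.
  have := trigm_mean_ge0 h; rewrite mulN1r /= subr_ge0; apply => t.
  by rewrite subr_ge0 lerXn2r ?nnegrE ?nm_ge0// (le_trans (nm_ge0 _) (gB 0)).
have h := trigmZ (e^-1 ^+ 2)%:C (trigm_sqr_horner (take_poly k g)).
rewrite -rmorphM in h.
have h' : trigm (size (take_poly k g))
    (fun t => (e^-1 ^+ 2 * nm (take_poly k g).[expi t] ^+ 2)%:C)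
    (e^-1 ^+ 2 * (\sum_(i < size (take_poly k g)) nm (take_poly k g)`_i ^+ 2))%:C.
  by apply: eq_trigm h => t; exact/esym/rmorphM.
apply: (@le_trans _ _ (e^-1 ^+ 2 * (\sum_(i < size (take_poly k g)) nm (take_poly k g)`_i ^+ 2))).
  apply: (trigm_markov h') => t; first by rewrite mulr_ge0 ?sqr_ge0.
  rewrite /= => et; rewrite -exprMn; apply: exprn_ege1.
  by rewrite mulrC ler_pdivlMr// mul1r ltW.
rewrite mulrC exprMn; apply: ler_wpM2r; first exact: sqr_ge0.
apply: le_trans sqB.
have st : (size (take_poly k g) <= size g)%N.
  by apply/leq_sizeP => j hj; rewrite coef_take_poly nth_default//; case: ifP.
rewrite (big_ord_widen _ (fun i => nm (take_poly k g)`_i ^+ 2) st).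
apply: le_trans (_ : \sum_(i < size g) nm (take_poly k g)`_i ^+ 2 <= _).
  by rewrite [leRHS](bigID (fun i : 'I__ => (i < size (take_poly k g))%N))/= lerDl sumr_ge0// => i _; rewrite sqr_ge0.
apply: ler_sum => i _; rewrite coef_take_poly.
by case: ifP => // _; rewrite nm0 expr0n sqr_ge0.
Qed.

(** The new value is (1 - y)x + y x f. If |x| <= dm, y is tiny; if |x| >= d1 and |f| <= s, both 1 -
    y and f are tiny; if |x| < d1 and |f| <= s <= 1, the modulus does not grow. In each case it
    stays at most d1. *)
Lemma damped_multiple_small (x f : R[i]) (y e1 s B BF d1 dm : R) :
  0 <= y <= 1 -> nm x <= B -> nm f <= BF ->
  (nm x <= dm -> y <= e1) -> (d1 <= nm x -> 1 - e1 <= y) ->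
  e1 * B * BF <= d1 - dm -> e1 * B <= d1 / 2 -> B * s <= d1 / 2 -> s <= 1 ->
  d1 < nm (x + y%:C * x * (f - 1)) -> dm <= nm x /\ s < nm f.
Proof.
move=> y01 xB fB ye1 y1 e1BF e1B sB s1 ht.
have x0 : 0 <= nm x by exact: nm_ge0.
have f0 : 0 <= nm f by exact: nm_ge0.
have hb : nm (x + y%:C * x * (f - 1)) <= (1 - y) * nm x + y * nm x * nm f.
  have -> : x + y%:C * x * (f - 1) = (1 - y)%:C * x + y%:C * x * f.
    by rewrite rmorphB /=; ring.
  rewrite (le_trans (nmD _ _))// !nmM !nm_real !ger0_norm//; lra.
have yx0 : 0 <= y * nm x by rewrite mulr_ge0//; lra.
split; [rewrite leNgt|rewrite ltNge].
- apply/negP => /ltW xdm; move: ht; apply/negP; rewrite -leNgt; apply: (le_trans hb).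
  have h1 : y * nm x * nm f <= e1 * B * BF.
    by apply: ler_pM => //; apply: ler_pM => //; [lra|exact: ye1].
  have h2 : (1 - y) * nm x <= nm x by rewrite -[leRHS]mul1r; apply: ler_wpM2r => //; lra.
  lra.
- apply/negP => fs; move: ht; apply/negP; rewrite -leNgt; apply: (le_trans hb).
  have [xd|xd] := leP d1 (nm x).
    have h0 := y1 xd.
    have h1 : (1 - y) * nm x <= e1 * B by apply: ler_pM => //; lra.
    have h2 : y * nm x * nm f <= B * s.
      by rewrite -[B in leRHS]mul1r; apply: ler_pM => //; apply: ler_pM => //; lra.
    lra.
  have h1 : y * nm x * nm f <= y * nm x.
    by rewrite -[leRHS]mulr1; apply: ler_wpM2l => //; exact: le_trans s1.
  lra.
Qed.

(** One step of the reduction, with u = theta r (F(z^n) - 1). By factoring of means, the dilated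
    factor is small on a proportion [gain] of the set where r is large. The frequencies of u start
    beyond N0, so that u can be appended to an earlier polynomial. *)
Lemma shrink_exceptional (r : R -> R[i]) (d0 d1 e : R) N0 :
  is_trig r -> 0 < d0 -> d0 < d1 -> 0 < e ->
  exists u, [/\ forall k, (k < N0)%N -> u`_k = 0,
    cmu [set t | d1 < nm (r t + u.[expi t])] <=
      (1 - gain) * cmu [set t | d0 < nm (r t)] + e &
    forall k, cmu [set t | e < nm (take_poly k u).[expi t] /\ nm (r t) <= d0] <= e].
Proof.
have freq_bounds (D D2 : nat) : let n := (D.*2 + N0 + D2 + 2)%N in
    [/\ 0 < n, D.*2.+1 <= n, D <= n, D2 < n & N0 <= n - D]%N.
  by move=> n; split; rewrite /n; lia.
move=> tr d00 d01 e0; have [B B1 rB] := is_trig_bound tr.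
have B0 : 0 < B by exact: lt_le_trans B1.
have d10 : 0 < d1 by exact: lt_trans d01.
pose e' := Num.min e 1.
have e'0 : 0 < e' by rewrite lt_min e0 ltr01.
have e'e : e' <= e by rewrite ge_min lexx.
have e'1 : e' <= 1 by rewrite ge_min lexx orbT.
(* This bound on the coefficients of F makes B a / (e/2) equal to e', so that Parseval leaves
   measure at most e'^2 <= e. *)
pose a := e * e' / (2 * B).
have a0 : 0 < a by rewrite divr_gt0 ?mulr_gt0.
pose s := Num.min 1 (d1 / (2 * B)).
have s0 : 0 < s by rewrite lt_min ltr01 divr_gt0 ?mulr_gt0.
have s1 : s <= 1 by rewrite ge_min lexx.
have sB : B * s <= d1 / 2.
  apply: (@le_trans _ _ (B * (d1 / (2 * B)))).
    by rewrite ler_wpM2l ?(ltW B0)// ge_min lexx orbT.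
  suff -> : B * (d1 / (2 * B)) = d1 / 2 by [].
  by field; rewrite gt_eqF.
have [F [TF [muF [[F0 Fa] [E hTF] muF1 TF0 TF1]]]] := contracting_factor a0 s0.
pose BF := 1 + coefsum F.
have BF1 : 1 <= BF by rewrite lerDl coefsum_ge0.
have BF0 : 0 < BF by exact: lt_le_trans BF1.
pose dm := (d0 + d1) / 2.
have d0m : d0 < dm by rewrite /dm; lra.
have dm1 : dm < d1 by rewrite /dm; lra.
pose eta := Num.min (d1 - dm) (Num.min (d1 / 2) (e / 2)).
have eta0 : 0 < eta by rewrite !lt_min subr_gt0 dm1 !divr_gt0.
have eta1 : eta <= d1 - dm by rewrite ge_min lexx.
have eta2 : eta <= d1 / 2 by rewrite !ge_min lexx orbT.
have eta3 : eta <= e / 2 by rewrite !ge_min lexx !orbT.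
pose e1 := eta / (2 * B * BF).
have e10 : 0 < e1 by rewrite divr_gt0 ?mulr_gt0.
have e1E : e1 * B * BF = eta / 2.
  by rewrite /e1; field; rewrite !gt_eqF.
have e1B0 : 0 <= e1 * B by rewrite mulr_ge0 ?ltW.
have e1B : e1 * B <= eta / 2.
  by rewrite -e1E -[leLHS]mulr1; apply: ler_wpM2l.
have e20 : 0 < e / 2 by rewrite divr_gt0.
(* Two cutoffs: [th] rises between dm and d1 and defines u; [T2] rises between d0 and dm and
   measures the set where |r| >= dm. *)
have [th [D1 [c1 [hth th01 th0 th1 _]]]] := trig_step tr (ltW (lt_trans d00 d0m)) dm1 e10.
have [T2 [D2 [c2 [hT2 T201 _ T21 c2le]]]] := trig_step tr (ltW d00) d0m e20.
have [D [c [g [sg Gg gc]]]] : is_trig ((fun t => (th t)%:C) \* r).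
  by apply: is_trigM => //; exists D1, c1.
(* n must exceed 2D so that copies of g do not overlap, exceed D2 for the means to factor, and be at
   least N0 + D to avoid low frequencies. *)
pose n := (D.*2 + N0 + D2 + 2)%N.
have [n0 Dn2 Dn D2n N0n] := freq_bounds D D2; rewrite -/n in n0 Dn2 Dn D2n N0n.
have sgn : (size g <= n)%N by exact: leq_trans sg Dn2.
pose H := drop_poly 1 F.
have FH x : F.[x] = 1 + x * H.[x].
  rewrite -{1}(poly_take_drop 1 F) hornerD hornerM expr1 hornerX mulrC.
  congr (_ + _); rewrite (_ : take_poly 1 F = 1%:P) ?hornerC//.
  apply/polyP => i; rewrite coef_take_poly coefC.
  by case: i => [|i] //=; rewrite F0.
(* This is theta r (F(z^n) - 1), since g = z^D theta r and F = 1 + xH on the circle. *)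
pose u := 'X^(n - D) * (g * (H \Po 'X^n)).
have nG t : nm g.[expi t] = th t * nm (r t).
  rewrite -Gg nmM nmX nm_expi expr1n mulr1 /= nmM nm_real ger0_norm//.
  by have /andP[] := th01 t.
have uE t : u.[expi t] = (th t)%:C * r t * (F.[expi (n%:R * t)] - 1).
  rewrite FH addrAC subrr add0r /u !hornerM horner_comp !hornerXn expiMn -Gg /=.
  have zn : expi t ^+ n = expi t ^+ (n - D) * expi t ^+ D by rewrite -exprD subnK.
  by move: H.[expi t ^+ n] => h; rewrite zn; ring.
have BFb k (x : R[i]) : nm x = 1 -> nm (take_poly k H).[x] <= BF.
  move=> x1; apply: (@le_trans _ _ (coefsum H)); first exact: coefsum_take.
  rewrite /BF; apply: ler_wpDl => //; rewrite /coefsum.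
  case: (posnP (size F)) => [sF|sF].
    by move: F0; rewrite nth_default ?sF// => /eqP; rewrite eq_sym oner_eq0.
  rewrite -(prednK sF) big_ord_recl /= ler_wpDl ?nm_ge0//.
  have sH : (size H <= (size F).-1)%N by rewrite size_drop_poly subn1.
  have -> : \sum_(i < size H) nm H`_i = \sum_(i < size H) nm F`_i.+1.
    by apply: eq_bigr => i _; rewrite coef_drop_poly addn1.
  rewrite (big_ord_widen _ (fun i => nm F`_i.+1) sH).
  by rewrite [leRHS](bigID (fun i : 'I__ => (i < size H)%N))/= lerDl sumr_ge0// => i _; exact: nm_ge0.
exists u; split.
- move=> k kN; rewrite coefXnM ifT//; exact: leq_trans kN N0n.
- have sub : [set t | d1 < nm (r t + u.[expi t])] `<=`
      [set t | dm <= nm (r t) /\ s < nm F.[expi (n%:R * t)]].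
    move=> t /=; rewrite uE; apply: (@damped_multiple_small _ _ _ e1 _ B BF) => //.
    - by apply: ler_wpDl => //; apply: coefsum_horner; exact: nm_expi.
    - exact: th0.
    - exact: th1.
    - by rewrite e1E; apply: le_trans eta1; rewrite ler_pdivrMr// ler_peMr ?ler1n// ltW.
    - apply: (le_trans e1B); apply: le_trans eta2.
      by rewrite ler_pdivrMr// ler_peMr ?ler1n// ltW.
  apply: le_trans (cmu_le sub) _.
  (* Raised by e/2, [T2] is at least 1 where |r| >= dm, so its product with TF(nt) majorizes the
     indicator sought. *)
  have hT2' : trigm D2 (fun t => (T2 t + e / 2)%:C) (c2 + (e / 2)%:C).
    apply: (@eq_trigm _ _ ((fun t => (T2 t)%:C) \+ (fun=> (e / 2)%:C))).
      by move=> t /=; rewrite rmorphD.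
    by apply: trigmD => //; exact: trigm_le (trigm_cst _).
  have T2'0 t : 0 <= T2 t + e / 2 by rewrite addr_ge0 ?(ltW e20)//; have /andP[] := T201 t.
  have c2'0 := trigm_mean_ge0 hT2' T2'0.
  have hM : trigm (D2 + n * E) (fun t => ((T2 t + e / 2) * TF (n%:R * t))%:C)
      ((c2 + (e / 2)%:C) * muF%:C).
    by apply: eq_trigm (trigm_dil D2n hT2' hTF) => t; rewrite rmorphM.
  apply: (@le_trans _ _ (Re ((c2 + (e / 2)%:C) * muF%:C))).
    apply: (trigm_markov hM) => t; first by rewrite mulr_ge0.
    move=> /= [rt ft]; rewrite -[leLHS]mulr1; apply: ler_pM => //; last exact: TF1.
    by have := T21 t rt; lra.
  have -> : Re ((c2 + (e / 2)%:C) * muF%:C) = Re (c2 + (e / 2)%:C) * muF.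
    by case: (c2 + _) => x y; rewrite /= mulr0 subr0.
  apply: (@le_trans _ _ (Re (c2 + (e / 2)%:C) * (1 - gain))); first exact: ler_wpM2l.
  rewrite ReD /= mulrC; set m := cmu _ in c2le *.
  have g1 : 0 <= 1 - (gain : R) <= 1 by rewrite /gain; lra.
  apply: (@le_trans _ _ ((1 - gain) * (m + e))).
    by apply: ler_wpM2l; lra.
  rewrite mulrDr lerD2l -[leRHS]mul1r ler_wpM2r//; lra.
- move=> k.
  have a2 : (B / (e / 2 / a)) ^+ 2 <= e.
    have -> : B / (e / 2 / a) = e'.
      by rewrite /a; field; rewrite !gt_eqF.
    by apply: le_trans e'e; rewrite expr2 -[leRHS]mulr1 ler_wpM2l// ltW.
  apply: le_trans a2.
  pose K := (k - (n - D))%N.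
  have gB t : nm g.[expi t] <= B.
    rewrite nG -[leRHS]mul1r; have /andP[y0 y1] := th01 t.
    by apply: ler_pM => //; exact: nm_ge0.
  apply: le_trans (parseval_take (K %% n)%N gB _); last by rewrite divr_gt0.
  apply: cmu_le => t /= [ht rt].
  move: ht; rewrite /u mulrC take_polyMXn -/K hornerM hornerXn nmM nmX nm_expi expr1n mulr1.
  rewrite take_poly_compXn// hornerD hornerM horner_comp hornerXn hornerZ hornerM hornerXn => ht.
  (* Complete copies of g: [th] is at most e1 where |r| <= d0, which beats the bound BF on the
     truncations of H. *)
  have h1 : nm (g.[expi t] * (take_poly (K %/ n) H).[expi t ^+ n]) <= e / 2.
    rewrite nmM nG; apply: le_trans eta3.
    apply: (@le_trans _ _ (e1 * B * BF)); last by rewrite e1E; lra.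
    have /andP[y0 y1] := th01 t.
    apply: ler_pM => //; rewrite ?nm_ge0 ?mulr_ge0 ?nm_ge0//.
      apply: ler_pM => //; first exact: nm_ge0.
      by apply: th0; lra.
    by apply: BFb; rewrite nmX nm_expi expr1n.
  (* The copy being cut carries a single coefficient of H, of modulus at most a. *)
  have h2 : nm (H`_(K %/ n) * ((take_poly (K %% n) g).[expi t] * expi t ^+ (K %/ n * n))) <=
     a * nm (take_poly (K %% n) g).[expi t].
    rewrite !nmM nmX nm_expi expr1n mulr1 ler_wpM2r ?nm_ge0//.
    by rewrite coef_drop_poly addn1 Fa.
  have := nmD (g.[expi t] * (take_poly (K %/ n) H).[expi t ^+ n])
   (H`_(K %/ n) * ((take_poly (K %% n) g).[expi t] * expi t ^+ (K %/ n * n))).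
  rewrite ltr_pdivrMr// [_ * a]mulrC; lra.
Qed.

(** Each step multiplies the exceptional measure by 1 - gain/2, while the threshold creeps up but
    stays below d2. The truncation bounds do not accumulate: a cut below the new frequencies cuts
    only the old A; a later one leaves A whole, with |A| <= 1 + d off the exceptional set, and cuts
    only u. *)
Lemma iterate_shrink A1 (d0 d2 k0 C : R) j : A1`_0 = 0 -> 0 < d0 -> d0 < d2 -> 0 < k0 ->
  2 + d2 <= C -> cmu [set t | d0 < nm (1 - A1.[expi t])] <= k0 ->
  (forall k, cmu [set t | C < nm (take_poly k A1).[expi t]] <= 2 * k0) ->
  exists A d, [/\ A`_0 = 0, d0 <= d < d2,
    cmu [set t | d < nm (1 - A.[expi t])] <= k0 * (1 - gain / 2) ^+ j &
    forall k, cmu [set t | C < nm (take_poly k A).[expi t]] <= 2 * k0].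
Proof.
move=> A10 d00 d02 k00 C2 A1k A1C; elim: j => [|j [A [d [A0 /andP[d0d dd2] Ak AC]]]].
  by exists A1, d0; split; rewrite ?lexx ?expr0 ?mulr1.
have g0 : 0 < (gain : R) by rewrite /gain.
have g1 : (gain : R) <= 1 by rewrite /gain; lra.
have q0 : 0 < 1 - gain / 2 :> R by lra.
have q1 : 1 - gain / 2 <= 1 :> R by lra.
set x := k0 * _ ^+ j in Ak.
have x0 : 0 < x by rewrite mulr_gt0// exprn_gt0.
have xk : x <= k0 by rewrite -[leRHS]mulr1 ler_wpM2l ?(ltW k00)// exprn_ile1// ltW.
(* Then (1 - gain) x + e <= (1 - gain/2) x, and e <= 1 gives 1 + d + e <= C. *)
pose e := Num.min 1 (x * (gain / 2)).
have e0 : 0 < e by rewrite lt_min ltr01 mulr_gt0// divr_gt0.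
have e1 : e <= 1 by rewrite ge_min lexx.
have ex : e <= x * (gain / 2) by rewrite ge_min lexx orbT.
have xg : x * (gain / 2) <= x by rewrite -[leRHS]mulr1 ler_wpM2l ?ltW//; lra.
pose d' := (d + d2) / 2.
have dd' : d < d' by rewrite /d'; lra.
have d'2 : d' < d2 by rewrite /d'; lra.
have tr : is_trig (fun t => 1 - A.[expi t]).
  by apply: (is_trigB (is_trig_cst 1)); exact: is_trig_horner.
have d_gt0 : 0 < d by exact: lt_le_trans d0d.
have [u [uN uk uC]] := shrink_exceptional (size A).+1 tr d_gt0 dd' e0.
exists (A - u), d'; split.
- by rewrite coefB A0 uN// subrr.
- by rewrite d'2 andbT (le_trans d0d)// ltW.
- have -> : [set t | d' < nm (1 - (A - u).[expi t])] =
     [set t | d' < nm (1 - A.[expi t] + u.[expi t])].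
    suff h t : 1 - (A - u).[expi t] = 1 - A.[expi t] + u.[expi t].
      by apply/seteqP; split => t /=; rewrite h.
    by rewrite hornerD hornerN; ring.
  apply: (le_trans uk); rewrite exprSr mulrA -/x.
  apply: (@le_trans _ _ ((1 - gain) * x + x * (gain / 2))).
    by apply: lerD => //; apply: ler_wpM2l => //; lra.
  by rewrite le_eqVlt; apply/orP; left; apply/eqP; field.
- move=> k; rewrite linearB /=.
  have [kA|kA] := leqP k (size A).
    have -> : take_poly k u = 0.
      apply/polyP => i; rewrite coef_take_poly coef0; case: ifP => // ik.
      by apply: uN; rewrite ltnS ltnW// (leq_trans ik).
    by rewrite subr0.
  rewrite take_poly_id 1?ltnW//.
  apply: (@le_trans _ _ (x + e)); last by lra.
  apply: (@le_trans _ _ (cmu [set t | d < nm (1 - A.[expi t])] +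
    cmu [set t | e < nm (take_poly k u).[expi t] /\ nm (1 - A.[expi t]) <= d])); last first.
    exact: lerD.
  apply: cmu_leU => t /= hC.
  have [h|h] := ltP d (nm (1 - A.[expi t])); [by left|right; split=> //].
  rewrite ltNge; apply/negP => h2; move: hC; apply/negP; rewrite -leNgt.
  rewrite hornerD hornerN; apply: (le_trans (nmB _ _)).
  have := nmB (1 : R[i]) (1 - A.[expi t]); rewrite nm1 opprB addrC subrK.
  by have := lt_trans dd' d'2; lra.
Qed.

(** Two stages. The first starts from A = 0, brings the exceptional measure to k0/2 and depends on d
    and k0 only; C is chosen to dominate its coefficients. The further steps, as many as k1 demands,
    keep this C. *)
Lemma analytic_one (d k0 : R) : 0 < d -> 0 < k0 -> exists2 C, 0 < C &
  forall k1, 0 < k1 -> exists A, [/\ A`_0 = 0,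
    cmu [set t | d < nm (1 - A.[expi t])] <= k1 &
    forall k, cmu [set t | C < nm (take_poly k A).[expi t]] <= k0].
Proof.
move=> d0 k00.
have g0 : 0 < (gain : R) by rewrite /gain.
have q1 : `|1 - gain / 2| < 1 :> R by rewrite ger0_norm; rewrite /gain; lra.
have small y : 0 < y -> exists j, (1 - gain / 2) ^+ j <= y :> R.
  move=> y0; have /cvgrPdist_le/(_ _ y0) [j _ /(_ j (leqnn j))] := cvg_expr q1.
  rewrite sub0r normrN => h; exists j; apply: le_trans h; exact: ler_norm.
have [j1 hj1] := small _ (divr_gt0 k00 (ltr0n R 2)).
have [A1 [d1 [A10 /andP[_ d1d] A1k _]]] :
  exists A d1, [/\ A`_0 = 0, d / 4 <= d1 < d / 2,
    cmu [set t | d1 < nm (1 - A.[expi t])] <= 1 * (1 - gain / 2) ^+ j1 &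
    forall k, cmu [set t | 2 + d / 2 < nm (take_poly k A).[expi t]] <= 2 * 1].
  (* The truncation bound of this stage is vacuous, as it allows measure 2. *)
  apply: (@iterate_shrink 0 _ _ 1) => //; rewrite ?coef0//; try lra.
  - exact: cmu_le1.
  - by move=> k; apply: le_trans (cmu_le1 _) _; lra.
pose C := 2 + d + coefsum A1.
have cA := coefsum_ge0 A1.
exists C; first by rewrite /C; lra.
move=> k1 k10.
have [j2 hj2] := small (k1 / (k0 / 2)) (divr_gt0 k10 (divr_gt0 k00 (ltr0n R 2))).
have [] := @iterate_shrink A1 (d / 2) d (k0 / 2) C j2 => //; rewrite /C; try lra.
- apply: le_trans (_ : cmu [set t | d1 < nm (1 - A1.[expi t])] <= _).
    by apply: cmu_le => t /=; exact: lt_trans.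
  by apply: (le_trans A1k); rewrite mul1r.
- move=> k; rewrite cmu_nil; first by lra.
  move=> t /=; apply/negP; rewrite -leNgt.
  have := coefsum_take k A1 (nm_expi t); lra.
move=> A [d' [A0 /andP[_ dd'] Ak AC]]; exists A; split=> //.
- apply: le_trans (_ : cmu [set t | d' < nm (1 - A.[expi t])] <= _).
    by apply: cmu_le => t /=; exact: lt_trans.
  apply: (le_trans Ak); rewrite mulrC -ler_pdivlMr//; lra.
- by move=> k; apply: le_trans (AC k) _; lra.
Qed.

End reduction.

(** * Density of trigonometric polynomials in measure *)

Section density.
Context {R : realType}.
Implicit Types (A B : set R) (g h : R -> R[i]).

Let I0 : set R := `[0%R, (pi *+ 2)%R[%classic.
Let mL A := measurable (A : set (lebesgueTypeR R)).

Let mLI A B : mL A -> mL B -> mL (A `&` B).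
Proof. exact: (@measurableI _ (lebesgueTypeR R)). Qed.

Let mLU A B : mL A -> mL B -> mL (A `|` B).
Proof. exact: (@measurableU _ (lebesgueTypeR R)). Qed.

Let mLC A : mL A -> mL (~` A).
Proof. exact: (@measurableC _ (lebesgueTypeR R)). Qed.

Let mLD A B : mL A -> mL B -> mL (A `\` B).
Proof. exact: (@measurableD _ (lebesgueTypeR R)). Qed.

Let mL0 : mL set0.
Proof. exact: (@measurable0 _ (lebesgueTypeR R)). Qed.

Lemma lebesgue_of_borel A : measurable (A : set (measurableTypeR R)) -> mL A.
Proof. exact: sub_caratheodory. Qed.

Lemma cmu_restrict A : cmu A = cmu (A `&` I0).
Proof. by rewrite /cmu /circle_measure -setIA setIid. Qed.

Lemma cmu_eq A B : (forall t, I0 t -> A t <-> B t) -> cmu A = cmu B.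
Proof.
move=> AB; rewrite cmu_restrict [RHS]cmu_restrict; congr cmu.
by apply/seteqP; split=> t [h It]; split=> //; apply/AB.
Qed.

(** Continuity from above of the completed measure, the intersection being empty. *)
Lemma cmu_nonincreasing (F : nat -> set R) e : (forall n, mL (F n)) ->
  (forall m n, (m <= n)%N -> F n `<=` F m) -> (forall t, exists n, ~ F n t) ->
  0 < e -> exists n, cmu (F n) <= e.
Proof.
move=> mF dF F0 e0.
pose mu := @completed_lebesgue_measure R.
have pi2 : 0 < pi *+ 2 :> R by rewrite pmulrn_rgt0// pi_gt0.
have mI : mL I0 by apply: lebesgue_of_borel; exact: measurable_itv.
have muE A : mu (A `&` I0) = (cmu A * (pi *+ 2))%:E.
  by rewrite mulrC EFinM -cmuE /circle_measure muleA -EFinM divff ?mul1e// gt_eqF.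
have fin0 : (mu (F 0%N `&` I0) < +oo)%E by rewrite muE ltry.
have mG i : mL (F i `&` I0) by exact: mLI.
have cap0 : \bigcap_n (F n `&` I0) = set0.
  rewrite -subset0 => t h; have [n] := F0 t; apply.
  by have [] := h n I.
have h : (mu (F n `&` I0) @[n --> \oo] --> mu set0)%E.
  rewrite -cap0; apply: (nonincreasing_cvg_mu fin0 mG).
    by rewrite cap0; exact: mL0.
  by move=> m n mn; apply/subsetPset; apply: setSI; exact: dF.
have mu0 : mu set0 = 0%E by exact: measure0.
rewrite mu0 in h.
have h1 : (fun n => cmu (F n) * (pi *+ 2)) @ \oo --> (0 : R).
  rewrite (_ : (fun _ => _) = fine \o (fun n => mu (F n `&` I0))).
    exact: fine_cvg.
  by apply/funext => n /=; rewrite muE.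
have e2 : 0 < e * (pi *+ 2) by rewrite mulr_gt0.
have /cvgrPdist_le/(_ _ e2) [n _ /(_ n (leqnn n))] := h1.
rewrite sub0r normrN => h2; exists n.
by rewrite -(ler_pM2r pi2); apply: le_trans h2; exact: ler_norm.
Qed.

Definition trig_approx g := forall e, 0 < e ->
  exists2 h, is_trig h & cmu [set t | e < nm (g t - h t)] <= e.

Lemma trig_approx_eq g g' : (forall t, I0 t -> g t = g' t) ->
  trig_approx g -> trig_approx g'.
Proof.
move=> gg ag e e0; have [h th hg] := ag e e0; exists h => //.
by rewrite (@cmu_eq _ [set t | e < nm (g t - h t)])// => t It; rewrite /= gg.
Qed.

Lemma trig_approx_limit g : (forall e, 0 < e -> exists2 g', trig_approx g' &
  cmu [set t | e < nm (g t - g' t)] <= e) -> trig_approx g.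
Proof.
move=> ag e e0; have e2 : 0 < e / 2 by rewrite divr_gt0.
have [g' /(_ _ e2) [h th hg'] gg'] := ag _ e2; exists h => //.
apply: (@le_trans _ _ (e / 2 + e / 2)); last by rewrite -splitr.
apply: le_trans (lerD gg' hg'); apply: cmu_leU => t /=.
have [h1|h1] := ltP (e / 2) (nm (g t - g' t)); [by left|right].
by have := nm_triangle (g t) (g' t) (h t); lra.
Qed.

Lemma trig_approx_trig g : is_trig g -> trig_approx g.
Proof.
move=> tg e e0; exists g => //; rewrite cmu_nil ?ltW// => t /=.
by rewrite subrr nm0 ltNge (ltW e0).
Qed.

Lemma trig_approxD g h : trig_approx g -> trig_approx h -> trig_approx (g \+ h).
Proof.
move=> ag ah e e0; have e2 : 0 < e / 2 by rewrite divr_gt0.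
have [g' tg gg] := ag _ e2; have [h' th hh] := ah _ e2.
exists (g' \+ h'); first exact: is_trigD.
apply: (@le_trans _ _ (e / 2 + e / 2)); last by rewrite -splitr.
apply: le_trans (lerD gg hh); apply: cmu_leU => t /=.
rewrite opprD addrACA => hlt.
have [h1|h1] := ltP (e / 2) (nm (g t - g' t)); [by left|right].
by have := nmD (g t - g' t) (h t - h' t); lra.
Qed.

Lemma trig_approxZ c g : trig_approx g -> trig_approx (fun t => c * g t).
Proof.
move=> ag e e0; have c1 : 0 < 1 + nm c by rewrite ltr_pwDl ?nm_ge0.
pose e' := e / (1 + nm c); have e'0 : 0 < e' by rewrite divr_gt0.
have e'e : e' <= e.
  by rewrite ler_pdivrMr// mulrDr mulr1 lerDl mulr_ge0 ?nm_ge0// ltW.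
have [g' tg gg] := ag _ e'0.
exists ((fun=> c) \* g'); first by apply: is_trigM => //; exact: is_trig_cst.
apply: le_trans e'e; apply: le_trans gg; apply: cmu_le => t /=.
rewrite -mulrBr nmM /e' ltr_pdivrMr// => h; apply: (lt_le_trans h).
by rewrite mulrC ler_wpM2l ?nm_ge0// lerDr.
Qed.

Lemma trig_approx_sum n (G : 'I_n -> R -> R[i]) : (forall i, trig_approx (G i)) ->
  trig_approx (fun t => \sum_(i < n) G i t).
Proof.
elim: n G => [|n ih] G aG.
  apply: (@trig_approx_eq (fun=> 0)) => [t _|]; first by rewrite big_ord0.
  by apply: trig_approx_trig; exact: is_trig_cst.
apply: (@trig_approx_eq (G ord0 \+ (fun t => \sum_(i < n) G (lift ord0 i) t))).
  by move=> t _; rewrite big_ord_recl.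
apply: trig_approxD => //; exact: ih.
Qed.

Let ind A (t : R) : R[i] := (\1_A t)%:C.

Let ind1 A t : A t -> ind A t = 1.
Proof. by move=> At; rewrite /ind indicE mem_set. Qed.

Let ind0 A t : ~ A t -> ind A t = 0.
Proof. by move=> At; rewrite /ind indicE memNset. Qed.

Let nm_ind A t : nm (ind A t) <= 1.
Proof.
by have [At|At] := pselect (A t); [rewrite ind1// nm1|rewrite ind0// nm0].
Qed.

(** Closed under complements and countable unions and containing the rays, this class will exhaust
    the Lebesgue measurable sets. *)
Definition approx_set A := mL A /\ trig_approx (ind A).

Lemma approx_setC A : approx_set A -> approx_set (~` A).
Proof.
move=> [mA aA]; split; first exact: mLC.
apply: (@trig_approx_eq ((fun=> 1) \+ (fun t => -1 * ind A t))).
  move=> t _ /=; have [At|At] := pselect (A t).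
    by rewrite ind1// ind0 ?mulr1 ?subrr//; apply.
  by rewrite ind0// ind1// mulr0 addr0.
apply: trig_approxD; last exact: trig_approxZ.
by apply: trig_approx_trig; exact: is_trig_cst.
Qed.

(** The approximants are multiplied; off the exceptional set the first has modulus at most 2, as e'
    <= 1. *)
Lemma approx_setI A B : approx_set A -> approx_set B -> approx_set (A `&` B).
Proof.
move=> [mA aA] [mB aB]; split; first exact: mLI.
move=> e e0; pose e' := Num.min 1 (e / 3).
have e'0 : 0 < e' by rewrite lt_min ltr01 divr_gt0.
have e'1 : e' <= 1 by rewrite ge_min lexx.
have e'e : e' <= e / 3 by rewrite ge_min lexx orbT.
have [g tg gg] := aA _ e'0; have [h th hh] := aB _ e'0.
exists (g \* h); first exact: is_trigM.
apply: (@le_trans _ _ (e' + e')); last by lra.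
apply: le_trans (lerD gg hh); apply: cmu_leU => t /=.
have -> : ind (A `&` B) t = ind A t * ind B t.
  by rewrite /ind indicI rmorphM.
move=> he; have [h1|h1] := ltP e' (nm (ind A t - g t)); [by left|right].
rewrite ltNge; apply/negP => h2; move: he; apply/negP; rewrite -leNgt.
have -> : ind A t * ind B t - g t * h t =
  (ind A t - g t) * ind B t + (ind A t - (ind A t - g t)) * (ind B t - h t) by ring.
apply: (le_trans (nmD _ _)); rewrite !nmM.
have hg : nm (ind A t - (ind A t - g t)) <= 2.
  by apply: (le_trans (nmB _ _)); have := nm_ind A t; lra.
have h3 : nm (ind A t - g t) * nm (ind B t) <= e' * 1 by apply: ler_pM; rewrite ?nm_ge0.
have h4 : nm (ind A t - (ind A t - g t)) * nm (ind B t - h t) <= 2 * e'.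
  by apply: ler_pM; rewrite ?nm_ge0.
lra.
Qed.

Lemma approx_setU A B : approx_set A -> approx_set B -> approx_set (A `|` B).
Proof.
by move=> aA aB; rewrite -(setCK A) -(setCK B) -setCI; apply: approx_setC;
  apply: approx_setI; exact: approx_setC.
Qed.

Lemma approx_set0 : approx_set set0.
Proof.
split; first exact: mL0.
apply: (@trig_approx_eq (fun=> 0)) => [t _|]; first by rewrite ind0.
by apply: trig_approx_trig; exact: is_trig_cst.
Qed.

(** Finite unions exhaust the countable one up to small measure. *)
Lemma approx_set_bigcup (F : nat -> set R) : (forall n, approx_set (F n)) ->
  approx_set (\bigcup_n F n).
Proof.
move=> aF; have mU : mL (\bigcup_n F n) by apply: (@bigcupT_measurable _ (lebesgueTypeR R)) => n; have [] := aF n.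
split=> //; pose U n := \big[setU/set0]_(i < n) F i.
have aU n : approx_set (U n).
  rewrite /U; elim: n => [|n ih]; first by rewrite big_ord0; exact: approx_set0.
  by rewrite big_ord_recr /=; exact: approx_setU.
apply: trig_approx_limit => e e0.
have [] := @cmu_nonincreasing (fun n => (\bigcup_n F n) `\` U n) e.
- by move=> n; apply: mLD => //; have [] := aU n.
- move=> m n mn t [h1 h2]; split=> // h3; apply: h2.
  by move: t h3 {h1}; apply: subset_bigsetU.
- move=> t; have [[n _ Fn]|h] := pselect ((\bigcup_n F n) t).
    by exists n.+1 => -[_]; apply; rewrite /U big_ord_recr /=; right.
  by exists 0%N => -[].
- by [].
move=> n hn; exists (ind (U n)); first by have [] := aU n.
apply: le_trans hn; apply: cmu_le => t /=.
have [h1|h1] := pselect (U n t).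
  rewrite (ind1 h1) ind1 ?subrr ?nm0 ?ltNge ?(ltW e0)//.
  by move: h1; rewrite /U -bigcup_mkord => -[i _ Fi]; exists i.
have [h2|h2] := pselect ((\bigcup_n F n) t); first by [].
by rewrite (ind0 h1) (ind0 h2) subrr nm0 ltNge (ltW e0).
Qed.

Lemma approx_set_eq A B : mL B -> (forall t, I0 t -> A t <-> B t) ->
  approx_set A -> approx_set B.
Proof.
move=> mB AB [mA aA]; split=> //; apply: trig_approx_eq aA => t It.
have [At|At] := pselect (A t); first by rewrite !ind1//; exact/AB.
by rewrite !ind0// => /(AB _ It).
Qed.

(** A cutoff rising between d and d + 1/(n + 1) can fail only where d < |G| <= d + 1/(n + 1), and
    these sets decrease to the empty set. *)
Lemma approx_trig_gt G d : is_trig G -> 0 <= d -> approx_set [set t | d < nm (G t)].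
Proof.
move=> tG d0; have mA c : mL [set t | c < nm (G t)].
  by apply: lebesgue_of_borel; exact: measurable_trig_gt.
split=> // e e0.
have [] := @cmu_nonincreasing
  (fun n => [set t | d < nm (G t)] `\` [set t | d + n.+1%:R^-1 < nm (G t)]) e => //.
- by move=> n; exact: mLD.
- move=> m n mn t /= [h1 h2]; split=> // h3; apply: h2.
  by apply: le_lt_trans h3; rewrite lerD2l lef_pV2 ?posrE// ler_nat.
- move=> t; have [h|h] := ltP d (nm (G t)); last first.
    by exists 0%N => /= -[]; rewrite ltNge h.
  have h' : 0 < nm (G t) - d by rewrite subr_gt0.
  have := ltr_add_invr h; move=> [n hn]; exists n => /= -[_]; exact.
move=> n hn; have dd : d < d + n.+1%:R^-1 by rewrite ltrDl invr_gt0.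
have [T [D [c [Tc T01 T0 T1 _]]]] := trig_step tG d0 dd e0.
exists (fun t => (T t)%:C); first by exists D, c.
apply: le_trans hn; apply: cmu_le => t /= he; split.
  apply/negP => /negP; rewrite -leNgt => h; move: he; apply/negP; rewrite -leNgt.
  rewrite ind0 /=; last by apply/negP; rewrite -leNgt.
  rewrite sub0r nmN nm_real ger0_norm; first exact: T0.
  by have /andP[] := T01 t.
move=> h; move: he; apply/negP; rewrite -leNgt.
rewrite ind1 /=; last exact: lt_trans h.
rewrite -(rmorph1 (real_complex R)) -rmorphB nm_real ger0_norm.
  by have := T1 t (ltW h); lra.
by have /andP[] := T01 t; lra.
Qed.

Lemma is_trig_cos : is_trig (fun t : R => (cos t)%:C).
Proof.
apply: (@eq_is_trig _ ((fun=> 2^-1) \* ((fun t => 'X.[expi t]) \+ (fun t => conjc 'X.[expi t])))).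
  by move=> t /=; rewrite hornerX addcJ mulrA mulVf ?mul1r// pnatr_eq0.
apply: is_trigM; first exact: is_trig_cst.
by apply: is_trigD; [|apply: is_trig_conj]; exact: is_trig_horner.
Qed.

Lemma is_trig_sin : is_trig (fun t : R => (sin t)%:C).
Proof.
apply: (@eq_is_trig _ ((fun=> (2%:R * 'i%C)^-1) \* ((fun t => 'X.[expi t]) \- (fun t => conjc 'X.[expi t])))).
  move=> t /=; rewrite hornerX subcJ mulrAC mulKf//.
  by rewrite mulf_neq0 ?pnatr_eq0// neq0Ci.
apply: is_trigM; first exact: is_trig_cst.
by apply: is_trigB; [|apply: is_trig_conj]; exact: is_trig_horner.
Qed.

(** Adding 2 makes f positive, hence equal to its modulus. *)
Lemma approx_real_gt (f : R -> R) c : is_trig (fun t => (f t)%:C) ->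
  (forall t, -1 <= f t <= 1) -> -1 <= c -> approx_set [set t | c < f t].
Proof.
move=> tf f1 c1.
have -> : [set t | c < f t] = [set t | 2 + c < nm ((2 + f t)%:C)].
  apply/seteqP; split=> t /=; rewrite nm_real ger0_norm ?ltrD2l//;
  by have /andP[] := f1 t; lra.
apply: (@approx_trig_gt (fun t => (2 + f t)%:C)); last by lra.
apply: (@eq_is_trig _ ((fun=> 2%:C) \+ (fun t => (f t)%:C))).
  by move=> t; exact/esym/rmorphD.
by apply: is_trigD => //; exact: is_trig_cst.
Qed.

Let cos_bd (t : R) : -1 <= cos t <= 1.
Proof. by rewrite cos_geN1 cos_le1. Qed.

Let sin_bd (t : R) : -1 <= sin t <= 1.
Proof. by rewrite sin_geN1 sin_le1. Qed.

Let approx_real_lt (f : R -> R) c : is_trig (fun t => (f t)%:C) ->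
  (forall t, -1 <= f t <= 1) -> c <= 1 -> approx_set [set t | f t < c].
Proof.
move=> tf f1 c1.
have -> : [set t | f t < c] = [set t | - c < - f t].
  by apply/seteqP; split=> t /=; rewrite ltrN2.
apply: approx_real_gt; last by lra.
  apply: (@eq_is_trig _ ((fun=> 0) \- (fun t => (f t)%:C))).
    by move=> t /=; rewrite sub0r rmorphN.
  by apply: is_trigB => //; exact: is_trig_cst.
by move=> t; have := f1 t; lra.
Qed.

(** On [0, 2 pi) the sign of sin separates the two half circles and cos is monotone on each, so
    conditions on sin and cos describe a ray there. *)
Lemma approx_ray (a : R) : approx_set `]a, +oo[%classic.
Proof.
have mray : mL `]a, +oo[%classic by apply: lebesgue_of_borel; exact: measurable_itv.
have p0 : 0 < pi :> R by exact: pi_gt0.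
have I0E t : I0 t <-> 0 <= t < pi + pi by rewrite /I0 /= in_itv/= -mulr2n.
have cpi (x : R) : cos x = - cos (x - pi).
  by rewrite cosB cospi sinpi mulr0 addr0 mulrN1 opprK.
have spi (x : R) : sin x = - sin (x - pi).
  by rewrite sinB cospi sinpi mulr0 subr0 mulrN1 opprK.
have sneg (x : R) : pi < x < pi + pi -> sin x < 0.
  by move=> hx; rewrite spi oppr_lt0 sin_gt0_pi//; lra.
have cosm (x y : R) : 0 <= x <= pi -> 0 <= y <= pi -> (cos x < cos y) = (y < x).
  by move=> hx hy; rewrite ltr_cos ?in_itv.
have [a0|a0] := ltP a 0.
  apply: (approx_set_eq mray _ (approx_setC approx_set0)) => t /I0E tI.
  by rewrite /= in_itv/= andbT; split=> // _; lra.
have [a2|a2] := leP (pi + pi) a.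
  apply: (approx_set_eq mray _ approx_set0) => t /I0E tI.
  by rewrite /= in_itv/= andbT; split=> //; lra.
have [ap|ap] := ltP a pi.
  apply: (@approx_set_eq ([set t | cos t < cos a] `|` [set t | sin t < 0])) => //.
    move=> t /I0E tI; rewrite /= in_itv/= andbT.
    have [tp|tp] := leP t pi.
      rewrite cosm; try lra.
      split=> [[//|]|]; last by left.
      by rewrite ltNge sin_ge0_pi//; lra.
    by split=> [_|_]; [lra|right; apply: sneg; lra].
  apply: approx_setU; apply: approx_real_lt => //.
  - exact: is_trig_cos.
  - exact: is_trig_sin.
apply: (@approx_set_eq ([set t | cos a < cos t] `&` [set t | sin t < 0])) => //.
  move=> t /I0E tI; rewrite /= in_itv/= andbT.
  have [tp|tp] := leP t pi.
    split=> [[_]|]; last by lra.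
    by rewrite ltNge sin_ge0_pi//; lra.
  have -> : (cos a < cos t) = (a < t).
    by rewrite (cpi a) (cpi t) ltrN2 cosm ?ltrD2r//; lra.
  by split=> [[]//|h]; split=> //; apply: sneg; lra.
apply: approx_setI.
  by apply: approx_real_gt; [exact: is_trig_cos|exact: cos_bd|exact: cos_geN1].
by apply: approx_real_lt => //; exact: is_trig_sin.
Qed.

Lemma approx_borel A : measurable (A : set (measurableTypeR R)) -> approx_set A.
Proof.
rewrite RGenOInfty.measurableE; apply: smallest_sub.
  split; first exact: approx_set0.
    by move=> B aB; rewrite setTD; exact: approx_setC.
  exact: approx_set_bigcup.
by move=> _ [x ->]; exact: approx_ray.
Qed.

(** A Lebesgue measurable set is a Borel set together with a negligible one. *)
Lemma approx_lebesgue A : mL A -> approx_set A.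
Proof.
move=> mA; split=> //; have := mA; rewrite /mL /lebesgueTypeR.
rewrite -completed_caratheodory_measurable g_sigma_completed_algebra_genE.
move=> [X mX [N [B [mB B0 NB]]] XN].
have [_ aX] := approx_borel mX.
apply: trig_approx_limit => e e0; exists (ind X) => //.
apply: (@le_trans _ _ (cmu B)).
  apply: cmu_le => t /=; rewrite -XN => ht; apply: NB.
  apply: contrapT => tN; move: ht.
  have [tX|tX] := pselect (X t).
    by rewrite !ind1 ?subrr ?nm0 ?ltNge ?(ltW e0)//; left.
  by rewrite !ind0 ?subrr ?nm0 ?ltNge ?(ltW e0)// => -[].
apply: le_trans (ltW e0); rewrite -lee_fin -cmuE /circle_measure.
rewrite completed_outerE -lebesgue_outerE.
have -> : lebesgue_measure (B `&` I0) = 0%E.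
  apply/eqP; rewrite eq_le -{1}B0 measure_ge0 andbT; apply: le_measure; rewrite ?inE//.
  by apply: measurableI => //; exact: measurable_itv.
by rewrite mule0.
Qed.

Lemma count_le_dist (x : R) n : 0 <= x < n%:R ->
  x - 1 <= \sum_(i < n) (if i.+1%:R <= x then 1 else 0) <= x.
Proof.
elim: n => [|n ih] /andP[x0 xn]; first by move: xn; rewrite ltNge x0.
rewrite big_ord_recr /= [n.+1%:R <= x]leNgt xn /= addr0.
have [h|h] := ltP x n%:R; first by apply: ih; rewrite x0.
rewrite (eq_bigr (fun=> 1)) => [|i _]; last first.
  by rewrite ifT// (le_trans _ h)// ler_nat.
rewrite sumr_const card_ord h andbT lerBlDr natr1; exact: ltW.
Qed.

(** Off a small set -K <= f < K. There (f + K) M is within 1 of the number of thresholds 1, ..., 2KM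
    that it reaches, so f is within 1/M of a combination of indicators of superlevel sets. *)
Lemma trig_approx_real (f : R -> R) :
  measurable_fun setT (f : lebesgueTypeR R -> measurableTypeR R) ->
  trig_approx (fun t => (f t)%:C).
Proof.
move=> mf; apply: trig_approx_limit => e e0.
have mge c : mL [set t | c <= f t].
  have -> : [set t | c <= f t] = setT `&` f @^-1` `[c, +oo[%classic.
    by rewrite setTI; apply/seteqP; split=> x /=; rewrite in_itv/= andbT.
  by apply: mf; [exact: measurableT|exact: measurable_itv].
have mge2 c : mL [set t | f t < c].
  have -> : [set t | f t < c] = ~` [set t | c <= f t].
    by apply/seteqP; split=> t /=; rewrite ltNge; move/negP.
  exact: mLC.
have [] := @cmu_nonincreasing
  (fun n => [set t | n%:R <= f t] `|` [set t | f t < - n%:R]) e => //.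
- by move=> n; exact: mLU.
- move=> m n mn t /= [h|h]; [left|right].
    by apply: le_trans h; rewrite ler_nat.
  by apply: (lt_le_trans h); rewrite lerN2 ler_nat.
- move=> t; have [n hn] : exists n, `|f t| < n%:R.
    by exists (Num.trunc `|f t|).+1; exact: truncnS_gt.
  by move: hn; rewrite ltr_norml => hn; exists n => /= -[h|h]; lra.
move=> K hK.
pose M := (Num.trunc e^-1).+1.
have M0 : 0 < M%:R :> R by rewrite ltr0n.
have Me : M%:R^-1 <= e.
  by rewrite -[leRHS]invrK lef_pV2 ?posrE ?invr_gt0//; apply: ltW; exact: truncnS_gt.
pose L i := [set t | i.+1%:R / M%:R - K%:R <= f t].
pose n := (2 * K * M)%N.
exists ((fun t => \sum_(i < n) (M%:R^-1)%:C * ind (L i) t) \+ (fun=> (- K%:R)%:C)).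
  apply: trig_approxD; last by apply: trig_approx_trig; exact: is_trig_cst.
  apply: (@trig_approx_sum n (fun i t => (M%:R^-1)%:C * ind (L i) t)) => i.
  by apply: trig_approxZ; have [] := approx_lebesgue (mge (i.+1%:R / M%:R - K%:R)).
apply: le_trans hK; apply: cmu_le => t /= he.
apply: contrapT => /not_orP[/negP]; rewrite -ltNge => fK /negP; rewrite -leNgt => Kf.
move: he; apply/negP; rewrite -leNgt.
pose x := (f t + K%:R) * M%:R.
have hx : 0 <= x < n%:R.
  rewrite /x; apply/andP; split; first by rewrite mulr_ge0 ?(ltW M0)//; lra.
  by rewrite /n !natrM ltr_pM2r//; lra.
have LE i : ind (L i) t = (if i.+1%:R <= x then 1 else 0 : R)%:C.
  have -> : (i.+1%:R <= x) = (i.+1%:R / M%:R - K%:R <= f t).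
    by rewrite /x lerBlDr ler_pdivrMr.
  by case: ifPn => h; [rewrite ind1|rewrite ind0//; exact/negP].
have -> : \sum_(i < n) (M%:R^-1)%:C * ind (L i) t =
   (M%:R^-1 * \sum_(i < n) (if i.+1%:R <= x then 1 else 0))%:C.
  rewrite mulr_sumr rmorph_sum; apply: eq_bigr => i _.
  by rewrite LE rmorphM.
rewrite -rmorphD -rmorphB nm_real; apply: le_trans Me.
have := count_le_dist hx; set S := \sum_(i < n) _ => hS.
have -> : f t - (M%:R^-1 * S - K%:R) = (x - S) / M%:R.
  by rewrite /x; field; rewrite gt_eqF.
rewrite normrM [`|_^-1|]ger0_norm ?invr_ge0 ?(ltW M0)//.
rewrite -[leRHS]mul1r; apply: ler_wpM2r; first by rewrite invr_ge0 ltW.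
rewrite ler_norml; lra.
Qed.

Lemma trig_approx_L0 (f : R -> R[i]) : L0_circle f -> trig_approx f.
Proof.
move=> [_ mr mi].
apply: (@trig_approx_eq ((fun t => (Re (f t))%:C) \+ (fun t => 'i%C * (Im (f t))%:C))).
  by move=> t _ /=; rewrite -complexE.
by apply: trig_approxD; [|apply: trig_approxZ]; exact: trig_approx_real.
Qed.

End density.

(** * Sparse lists of frequencies *)

Section take_blocks.
Context {C : nzRingType}.

Lemma size_sum_blocks (P : nat -> {poly C}) (lo : nat -> nat) J :
  (forall j, (size (P j) <= lo j.+1)%N) -> (forall j, (lo j <= lo j.+1)%N) ->
  (size (\sum_(i < J) P i)%R <= lo J)%N.
Proof.
move=> sP lo1; elim: J => [|J ih]; first by rewrite big_ord0 size_poly0.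
rewrite big_ord_recr /= (leq_trans (size_polyD _ _))// geq_max sP andbT.
exact: leq_trans ih _.
Qed.

(** P_j occupies [lo j, lo (j + 1)), so a cut falls in a single block: the earlier ones are complete
    and the later ones disappear. *)
Lemma take_sum_blocks (P : nat -> {poly C}) (lo : nat -> nat) J0 n k :
  (forall j, (size (P j) <= lo j.+1)%N) -> (forall j, (lo j <= lo j.+1)%N) ->
  (forall j i, (i < lo j)%N -> (P j)`_i = 0) -> (lo J0 <= k)%N ->
  exists j, [/\ (J0 <= j)%N, (j < J0 + n.+1)%N &
   take_poly k (\sum_(i < J0 + n.+1) P i) = \sum_(i < j) P i + take_poly k (P j)].
Proof.
move=> sP lo1 P0 J0k.
have full j : (lo j <= k)%N -> take_poly k (\sum_(i < j) P i) = \sum_(i < j) P i.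
  by move=> h; rewrite take_poly_id// (leq_trans (size_sum_blocks j sP lo1)).
elim: n => [|n [j [J0j jn ih]]].
  exists J0; split=> //; first by rewrite addn1.
  by rewrite addn1 big_ord_recr /= take_polyD full.
have [h|h] := leqP (lo (J0 + n.+1)%N) k.
  exists (J0 + n.+1)%N; split; rewrite ?leq_addr//; first by rewrite ltn_add2l.
  by rewrite [in LHS]addnS big_ord_recr /= take_polyD full.
exists j; split=> //; first by rewrite (leq_trans jn)// leq_add2l.
rewrite addnS big_ord_recr /= take_polyD ih [X in _ + X](_ : _ = 0) ?addr0//.
apply/polyP => i; rewrite coef_take_poly coef0; case: ifP => // ik.
by apply: P0; exact: ltn_trans ik h.
Qed.

Lemma take_compXn (p : {poly C}) n k : (0 < n)%N ->
  exists j, take_poly k (p \Po 'X^n) = take_poly j p \Po 'X^n.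
Proof.
(* The ceiling of k/n: a multiple nm is below k exactly when m is below it. *)
move=> n0; exists ((k + n.-1) %/ n)%N; apply/polyP => i.
rewrite coef_take_poly !coef_comp_poly_Xn//.
case: ifP => [ik|ik]; case: ifP => // /dvdnP [m mi]; rewrite coef_take_poly.
  rewrite ifT// mi mulnK// leq_divRL// mulSn.
  by move: ik; rewrite mi; lia.
rewrite ifF// mi mulnK//; apply/negbTE; rewrite -leqNgt -ltnS ltn_divLR// mulSn.
by move: ik; rewrite mi => /negbT; lia.
Qed.

End take_blocks.

(** * Sparse lists and arithmetic progressions *)

Section good_lists.
Context {R : realType}.
Variable eps : nat -> R.
Hypothesis eps_gt0 : forall n, (1 <= n)%N -> 0 < eps n.

(* The entry of index [i] of a list is [lambda(i + 1)]. *)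
Definition sparse (l : seq nat) :=
  (forall i, (i < size l)%N -> (0 < nth 0%N l i)%N) /\
  (forall i, (i.+1 < size l)%N ->
    (1 + eps i.+1) * (nth 0%N l i)%:R < (nth 0%N l i.+1)%:R).

Lemma sparse_nil : sparse [::].
Proof. by []. Qed.

Lemma sparse_lt l i j : sparse l -> (i < j)%N -> (j < size l)%N ->
  (nth 0 l i < nth 0 l j)%N.
Proof.
move=> [l0 l1]; elim: j => // j ih; rewrite ltnS => ij jl.
have h : (nth 0 l j < nth 0 l j.+1)%N.
  rewrite -(ltr_nat R); apply: le_lt_trans (l1 _ jl).
  by rewrite -[leLHS]mul1r ler_wpM2r// lerDl ltW// eps_gt0.
move: ij; rewrite leq_eqVlt => /orP[/eqP->//|ij].
by apply: ltn_trans h; apply: ih => //; exact: ltnW.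
Qed.

Lemma sparse_ge l i : sparse l -> (i < size l)%N -> (i < nth 0 l i)%N.
Proof.
move=> sl; elim: i => [|i ih] il; first by have [h _] := sl; exact: h.
apply: (leq_ltn_trans (ih (ltnW il))); exact: sparse_lt.
Qed.

Lemma sparse_rcons l n : sparse l ->
  (forall i, i.+1 = size l -> (1 + eps i.+1) * (nth 0%N l i)%:R < n%:R) -> (0 < n)%N ->
  sparse (rcons l n).
Proof.
move=> [l0 l1] ln n0; split=> i; rewrite size_rcons ltnS => il; rewrite !nth_rcons.
  move: il; rewrite leq_eqVlt => /orP[/eqP->|h]; first by rewrite ltnn eqxx.
  by rewrite h; exact: l0.
rewrite il; move: il; rewrite leq_eqVlt => /orP[/eqP h|h].
  have -> : (i.+1 < size l)%N = false by rewrite h ltnn.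
  by rewrite h eqxx -h; exact: ln.
by rewrite h; exact: l1.
Qed.

Definition progression (L n c : nat) := [seq (n * j + c)%N | j <- iota 0 L].

Lemma progressionS L n c : progression L.+1 n c = rcons (progression L n c) (n * L + c)%N.
Proof. by rewrite /progression -addn1 iotaD map_cat -cats1. Qed.

Lemma size_progression L n c : size (progression L n c) = L.
Proof. by rewrite size_map size_iota. Qed.

(** In the progression the gap is n and a term with a successor is at most n(L + 1), so eps (L + 1)
    < 1 suffices. The first term is at least n - d, and n0 makes it outgrow the last entry of l. *)
Lemma sparse_cat_progression l L d : sparse l ->
  (forall p, (size l < p)%N -> eps p * L.+1%:R < 1) ->
  exists n0, forall n c, (n0 <= n)%N -> (n <= c + d)%N -> (c <= n + d)%N ->
    sparse (l ++ progression L n c).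
Proof.
move=> sl epsL; pose v := (1 + eps (size l)) * (last 0%N l)%:R.
have [T vT] : exists T, v < T.+1%:R by exists (Num.trunc v); exact: truncnS_gt.
exists (d + T.+1)%N => n c nn0 ncd cnd.
have vc : v < c%:R.
  apply: lt_le_trans vT _; rewrite ler_nat.
  by move: nn0 ncd; lia.
have c0 : (0 < c)%N by move: nn0 ncd; lia.
have nd : (d <= n)%N by move: nn0; lia.
have n0 : (0 < n)%N by move: nn0; lia.
suff h K : (K <= L)%N -> sparse (l ++ progression K n c) by exact: h.
elim: K => [|K ih] KL; first by rewrite cats0.
rewrite progressionS -rcons_cat; apply: sparse_rcons.
- exact: ih (ltnW KL).
- move=> i; rewrite size_cat size_progression => iE.
  case: K ih KL iE => [|K] ih KL iE.
    rewrite muln0 add0n cats0; move: iE; rewrite addn0 => iE.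
    by move: vc; rewrite /v -iE (last_nth 0%N) -iE.
  have -> : i = (size l + K)%N by move: iE; lia.
  rewrite nth_cat ltnNge leq_addr /= addKn (nth_map 0%N) ?size_iota// nth_iota// add0n.
  have h1 : (n * K + c <= n * L.+1)%N.
    have : (n * K.+2 <= n * L)%N by rewrite leq_mul2l KL orbT.
    by rewrite !mulnS; move: cnd nd; lia.
  have := epsL (size l + K).+1; rewrite ltnS leq_addr => /(_ isT) h2.
  have e0 := eps_gt0 (ltn0Sn (size l + K)).
  rewrite mulrDl mul1r (_ : (n * K.+1 + c)%:R = (n * K + c)%:R + n%:R); last first.
    by rewrite -natrD mulnS; congr _%:R; lia.
  rewrite ltrD2l; apply: (@le_lt_trans _ _ (eps (size l + K).+1 * (n * L.+1)%:R)).
    by rewrite ler_wpM2l ?ler_nat// ltW.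
  rewrite natrM mulrCA -[ltRHS]mulr1 ltr_pM2l// ltr0n//.
- by rewrite addn_gt0 c0 orbT.
Qed.

Lemma sparse_filler l p0 : sparse l -> exists l', [/\ sparse (l ++ l'),
  (p0 <= size (l ++ l'))%N & l' != [::] ].
Proof.
move=> sl.
have step l1 : sparse l1 -> exists n, sparse (rcons l1 n).
  move=> s1; pose v := (1 + eps (size l1)) * (last 0%N l1)%:R.
  exists (Num.trunc v).+1; apply: sparse_rcons => // i iE.
  by apply: le_lt_trans (truncnS_gt v); rewrite /v -iE (last_nth 0%N) -iE.
suff [l' [s' h]] : exists l', sparse (l ++ l') /\ size l' = p0.+1.
  exists l'; split=> //; last by case: l' h {s'}.
  by rewrite size_cat h; lia.
elim: p0.+1 => [|p [l' [s' h]]]; first by exists [::]; rewrite cats0.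
have [n hn] := step _ s'; exists (rcons l' n); rewrite -rcons_cat; split=> //.
by rewrite size_rcons h.
Qed.

Fixpoint progressions (L : nat) (ns cs : nat -> nat) (S : nat) : seq nat :=
  if S is S'.+1 then progressions L ns cs S' ++ progression L (ns S') (cs S') else [::].

Lemma eq_progressions L ns ns' cs cs' S : (forall s, (s < S)%N -> ns s = ns' s) ->
  (forall s, (s < S)%N -> cs s = cs' s) ->
  progressions L ns cs S = progressions L ns' cs' S.
Proof.
elim: S => //= S ih h1 h2; rewrite h1// h2// ih// => s sS;
by [apply: h1; rewrite ltnS ltnW|apply: h2; rewrite ltnS ltnW].
Qed.

(** The steps are chosen one by one, each large compared with the list already built; their growth
    keeps successive progressions apart. *)
Lemma sparse_cat_progressions l L d (m : nat -> nat) S : sparse l ->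
  (forall p, (size l < p)%N -> eps p * L.+1%:R < 1) -> (forall s, (m s <= d.*2)%N) ->
  exists ns : nat -> nat, [/\ forall s, (d < ns s)%N,
    forall s, (ns s * L + d.*2 + 1 <= ns s.+1)%N &
    sparse (l ++ progressions L ns (fun s => ns s + m s - d)%N S)].
Proof.
move=> sl epsL md; elim: S => [|S [ns [nd nL sp]]].
  exists (fun s => iter s (fun n => n * L + d.*2 + 1)%N d.+1); split.
  - by case=> [|s] /=; lia.
  - by move=> s /=.
  - by rewrite /= cats0.
set q := progressions _ _ _ _ in sp.
have [|n0 hn0] := @sparse_cat_progression (l ++ q) L d sp.
  by move=> p hp; apply: epsL; apply: leq_ltn_trans hp; rewrite size_cat leq_addr.
pose f n := (n * L + d.*2 + 1)%N.
pose N := (n0 + ns S)%N.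
(* Steps below S are kept; from S on the minimal growth is iterated, so that the growth conditions
   hold for every s. *)
pose ns' s := if (s < S)%N then ns s else iter (s - S) f N.
exists ns'; split.
- move=> s; rewrite /ns'; case: ifP => // h.
  have : (d < N)%N by rewrite /N ltn_addl.
  by case: (s - S)%N => [|k] //= _; rewrite /f; lia.
- move=> s; rewrite /ns'; case: ltnP => h1; case: ltnP => h2; try by lia.
  + exact: nL.
  + have -> : s.+1 = S by lia.
    rewrite subnn /= /N; have -> : S = s.+1 by lia.
    by apply: leq_trans (nL s) _; rewrite leq_addl.
  + by rewrite subSn.
- rewrite /= (eq_progressions L (_ : forall s, (s < S)%N -> ns' s = ns s)
    (_ : forall s, (s < S)%N -> (ns' s + m s - d)%N = (ns s + m s - d)%N)).
  + rewrite catA; apply: hn0; rewrite /ns' ltnn subnn /= /N.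
    * exact: leq_addr.
    * by have := nd S; lia.
    * by have := md S; lia.
  + by move=> s sS; rewrite /ns' sS.
  + by move=> s sS; rewrite /ns' sS.
Qed.

Lemma mem_progressions L ns cs S s j : (s < S)%N -> (j < L)%N ->
  (ns s * j + cs s)%N \in progressions L ns cs S.
Proof.
elim: S => // S ih; rewrite ltnS leq_eqVlt => /orP[/eqP->|sS] jL /=.
  rewrite mem_cat; apply/orP; right; apply/mapP; exists j => //.
  by rewrite mem_iota.
by rewrite mem_cat ih.
Qed.

End good_lists.

(** * Blocks of frequencies *)

Lemma sum_modn (V : zmodType) (F : nat -> V) w q r : (r <= w)%N ->
  \sum_(s < q * w + r) F (s %% w)%N = (\sum_(m < w) F m) *+ q + \sum_(m < r) F m.
Proof.
move=> rw; elim: q => [|q ih].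
  rewrite mulr0n add0r; apply: eq_bigr => i _.
  by rewrite modn_small// (leq_trans (ltn_ord i)).
rewrite mulSn -addnA big_split_ord /=.
under [X in _ + X]eq_bigr do rewrite modnDl.
rewrite ih mulrS addrA; congr (_ + _ + _).
by apply: eq_bigr => i _; rewrite modn_small.
Qed.

Section block.
Context {R : realType}.

Lemma cmu_exists_lt (E : nat -> set R) S k : (forall s, (s < S)%N -> cmu (E s) <= k) ->
  cmu [set t | exists2 s, (s < S)%N & E s t] <= S%:R * k.
Proof.
elim: S => [|S ih] h.
  by rewrite mul0r cmu_nil// => t /= -[].
rewrite -natr1 mulrDl mul1r.
apply: le_trans (lerD (ih _) (h S (ltnSn S))); last by move=> s sS; apply: h; exact: ltnW.
apply: cmu_leU => t /= [s]; rewrite ltnS leq_eqVlt => /orP[/eqP->|sS] Et; first by right.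
by left; exists s.
Qed.

(** H stands for the trigonometric polynomial z^(-d) H(z) of degree at most d. The error scales with
    [coefsum H], so that one list serves all H. *)
Definition represents d (e : R) (l : seq nat) := forall H : {poly R[i]},
  (size H <= d.*2.+1)%N -> exists P : {poly R[i]},
  [/\ forall k, P`_k != 0 -> k \in l,
      cmu [set t | e * coefsum H < nm (expi t ^+ d * P.[expi t] - H.[expi t])] <= e &
      forall k, exists2 q : R, 0 <= q <= 1 & 
        cmu [set t | e * coefsum H <
          nm (expi t ^+ d * (take_poly k P).[expi t] - q%:C * H.[expi t])] <= e].

Variable eps : nat -> R.
Hypothesis eps_gt0 : forall n, (1 <= n)%N -> 0 < eps n.

(** Each of the w = 2d + 1 terms of H is split into M equal copies, and each copy is multiplied by
    its own dilate of A. The copies run cyclically over the terms: a cut in progression j leaves (j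
    div w)/M times H, fewer than w terms of an unfinished cycle, and one cut dilate. The last two
    are O(1/M) times [coefsum H]. *)
Lemma sparse_block d (e : R) : 0 < e -> exists L, forall l, sparse eps l ->
  (forall p, (size l < p)%N -> eps p * L.+1%:R < 1) ->
  exists l', sparse eps (l ++ l') /\ represents d e l'.
Proof.
move=> e0; have e2 : 0 < e / 2 by rewrite divr_gt0.
have e4 : 0 < e / 4 by rewrite divr_gt0.
have [C0 C00 hA] := analytic_one e4 e2.
pose C := C0 + 1.
pose M := (Num.trunc (2 * (1 + C) / e)).+1.
have M0 : 0 < M%:R :> R by rewrite ltr0n.
have MC : (1 + C) / M%:R <= e / 2.
  rewrite ler_pdivrMr// mulrC -ler_pdivrMr//.
  have -> : (1 + C) / (e / 2) = 2 * (1 + C) / e by field; rewrite gt_eqF.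
  by apply: ltW; exact: truncnS_gt.
pose w := d.*2.+1; pose S := (M * w)%N.
have S0 : (0 < S)%N by rewrite muln_gt0.
have SR : 0 < S%:R :> R by rewrite ltr0n.
(* C0 fixes M and S, and only now is A chosen, with exceptional measure e/(2S) so that S dilates
   cost e/2. The uniformity of C0 in [analytic_one] is used here. *)
have [A [A0 A1 AC]] := hA (e / 2 / S%:R) (divr_gt0 e2 SR).
pose A' := drop_poly 1 A; pose L := size A'.
have AE j x : (take_poly j.+1 A).[x] = x * (take_poly j A').[x].
  have -> : take_poly j.+1 A = take_poly j A' * 'X.
    apply/polyP => i; rewrite coefMX !coef_take_poly.
    by case: i => [|i] /=; rewrite ?A0// ltnS coef_drop_poly addn1.
  by rewrite hornerM hornerX mulrC.
have AE' x : A.[x] = x * A'.[x].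
  have h := AE (size A) x; rewrite !take_poly_id// in h.
  by rewrite (leq_trans _ (leq_subr 1 _))// size_drop_poly.
exists L => l sl epsL.
pose m s := (s %% w)%N.
have md s : (m s <= d.*2)%N by rewrite -ltnS ltn_mod.
have [ns [nd nL sp]] := sparse_cat_progressions eps_gt0 S sl epsL md.
pose c s := (ns s + m s - d)%N.
exists (progressions L ns c S); split=> // H sH.
pose al s : R[i] := H`_(m s) / M%:R.
pose P s := al s *: ('X^(c s) * (A' \Po 'X^(ns s))).
pose Pf := \sum_(s < S) P s.
have ns0 s : (0 < ns s)%N by exact: leq_ltn_trans (nd s).
have coefP s k : (k \notin progressions L ns c S) -> (s < S)%N -> (P s)`_k = 0.
  move=> kl sS; rewrite coefZ coefXnM; case: ifPn; first by rewrite mulr0.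
  rewrite -leqNgt => ck; rewrite coef_comp_poly_Xn//; case: ifP; last by rewrite mulr0.
  move=> /dvdnP[j jE]; rewrite jE mulnK// nth_default ?mulr0// leqNgt.
  apply: contra kl => jL.
  have -> : k = (ns s * j + c s)%N by rewrite mulnC -jE subnK.
  exact: mem_progressions.
(* An upper end for the frequencies of the first s progressions; by [loP] the later ones start at or
   beyond it. *)
pose lo s := if s is s'.+1 then (ns s' * L + d + 1)%N else 0%N.
have loS s : (size (P s) <= lo s.+1)%N.
  rewrite /P; apply: leq_trans (size_scale_leq _ _) _.
  have [A'0|A'0] := eqVneq A' 0; first by rewrite A'0 comp_poly0 mulr0 size_poly0.
  have L0 : (0 < L)%N by rewrite size_poly_gt0.
  apply: leq_trans (size_polyMleq _ _) _; rewrite size_polyXn /=.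
  have := size_comp_poly_leq A' 'X^(ns s); rewrite size_polyXn /= -/L.
  have cd : (c s <= ns s + d)%N by rewrite /c; have := md s; lia.
  have -> : (L.-1 * ns s = ns s * L - ns s)%N by rewrite -subn1 mulnBl mul1n mulnC.
  have : (ns s <= ns s * L)%N by rewrite leq_pmulr.
  by move: cd; move: (ns s * L)%N (c s) (size _) => x1 x2 x3; lia.
have lo1 s : (lo s <= lo s.+1)%N.
  case: s => [|s] //=; rewrite !leq_add2r; case: (posnP L) => [->|L0]; first by rewrite !muln0.
  apply: (@leq_trans (ns s.+1)); last by rewrite leq_pmulr.
  by have := nL s; lia.
have loP s i : (i < lo s)%N -> (P s)`_i = 0.
  move=> ilo; rewrite coefZ coefXnM ifT ?mulr0//; apply: leq_trans ilo _.
  case: s => [|s] //=; rewrite /c.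
  by have := nL s; have := nd s.+1; lia.
have evalP s t : expi t ^+ d * (P s).[expi t] =
    al s * (expi t ^+ m s * A.[expi ((ns s)%:R * t)]).
  rewrite hornerZ hornerM horner_comp !hornerXn expiMn AE'.
  have -> : expi t ^+ d * (al s * (expi t ^+ c s * A'.[expi t ^+ ns s])) =
    al s * (expi t ^+ (d + c s) * A'.[expi t ^+ ns s]) by rewrite exprD; ring.
  have -> : (d + c s = m s + ns s)%N by rewrite /c; have := nd s; lia.
  by rewrite exprD; ring.
have evalT s k : exists j, forall t, nm (expi t ^+ d * (take_poly k (P s)).[expi t]) =
    nm (al s) * nm (take_poly j A).[expi ((ns s)%:R * t)].
  have [j hj] := take_compXn A' (k - c s) (ns0 s).
  exists j.+1 => t; rewrite take_polyZ ['X^_ * _]mulrC take_polyMXn hj.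
  rewrite AE hornerZ hornerM horner_comp !hornerXn expiMn.
  by rewrite !nmM !nmX nm_expi !expr1n !mulr1 !mul1r.
have csE : \sum_(m < w) nm H`_m = coefsum H.
  rewrite /coefsum (big_ord_widen _ (fun i => nm H`_i) sH) [LHS](bigID (fun i : 'I__ => (i < size H)%N)) /=.
  rewrite [X in _ + X]big1 ?addr0// => i; rewrite -leqNgt => hi.
  by rewrite nth_default// nm0.
have cs0 := coefsum_ge0 H; set cs := coefsum H in csE cs0 *.
have alE s : nm (al s) = nm H`_(m s) / M%:R.
  rewrite /al nmM; congr (_ * _).
  have -> : (M%:R^-1 : R[i]) = (M%:R^-1)%:C by rewrite fmorphV rmorph_nat.
  by rewrite nm_real ger0_norm// invr_ge0.
have HE t : \sum_(m < w) H`_m * expi t ^+ m = H.[expi t].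
  by rewrite (horner_coef_wide _ sH).
have als j : (j <= S)%N -> \sum_(s < j) nm (al s) <= cs.
  move=> jS; apply: (@le_trans _ _ (\sum_(s < S) nm (al s))).
    rewrite (big_ord_widen _ (fun s => nm (al s)) jS).
    by rewrite [leRHS](bigID (fun i : 'I__ => (i < j)%N))/= lerDl sumr_ge0// => i _; exact: nm_ge0.
  under eq_bigr do rewrite alE.
  have hS : \sum_(s < S) nm H`_(m s) = cs *+ M.
    have := sum_modn (fun k => nm H`_k) M (leq0n w).
    by rewrite addn0 big_ord0 addr0 csE.
  by rewrite -mulr_suml hS -[_ *+ M]mulr_natr mulfK// gt_eqF.
have al1 s : nm (al s) <= cs / M%:R.
  rewrite alE ler_wpM2r ?invr_ge0 ?(ltW M0)// -csE.
  have mw : (m s < w)%N by rewrite ltn_mod.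
  by rewrite (bigD1 (Ordinal mw))//= lerDl sumr_ge0// => i _; exact: nm_ge0.
(* The threshold is e/2 rather than e/4 because [cmu_dilation] needs slack; likewise C = C0 + 1. *)
pose E s : set R := [set t | e / 2 < nm (1 - A.[expi ((ns s)%:R * t)])].
have tA1 : is_trig (fun t => 1 - A.[expi t]).
  by apply: (is_trigB (is_trig_cst 1)); exact: is_trig_horner.
have muE s : cmu (E s) <= e / 2 / S%:R.
  apply: le_trans A1; apply: (cmu_dilation tA1) => //; first exact: ltW.
  by rewrite ltr_pM2l// ltf_pV2 ?posrE// ltr_nat.
pose Bad := [set t | exists2 s, (s < S)%N & E s t].
have muBad : cmu Bad <= e / 2.
  by apply: le_trans (cmu_exists_lt (fun s _ => muE s)) _; rewrite mulrCA divff ?mulr1// gt_eqF.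
have main t j : ~ Bad t -> (j <= S)%N ->
  nm (\sum_(s < j) expi t ^+ d * (P s).[expi t] -
      \sum_(s < j) al s * expi t ^+ m s) <= cs * (e / 2).
  move=> nb jS; rewrite -sumrB; apply: le_trans (nm_sum _ _ _) _.
  apply: (@le_trans _ _ (\sum_(s < j) nm (al s) * (e / 2))); last first.
    by rewrite -mulr_suml ler_wpM2r ?(ltW e2)// als.
  apply: ler_sum => s _; rewrite evalP -mulrBr nmM ler_wpM2l ?nm_ge0//.
  rewrite -[X in _ - X]mulr1 -mulrBr nmM nmX nm_expi expr1n mul1r nm_distC leNgt.
  apply/negP => h; apply: nb; exists s => //.
  exact: leq_trans (ltn_ord s) jS.
have alsum t q r : (r <= w)%N -> \sum_(s < q * w + r) al s * expi t ^+ m s =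
   (q%:R / M%:R) * H.[expi t] + (\sum_(k < r) H`_k * expi t ^+ k) / M%:R.
  move=> rw; under eq_bigr do rewrite /al mulrAC.
  rewrite -mulr_suml (sum_modn (fun k => H`_k * expi t ^+ k))// HE.
  by rewrite mulrDl; congr (_ + _); rewrite -[H.[_] *+ q]mulr_natl mulrAC.
have evalsum t j : expi t ^+ d * (\sum_(s < j) P s).[expi t] =
    \sum_(s < j) expi t ^+ d * (P s).[expi t].
  by rewrite horner_sum mulr_sumr.
exists Pf; split.
- move=> k; apply: contraR => kl; rewrite /Pf coef_sum big1// => s _.
  exact: coefP.
- apply: (@le_trans _ _ (cmu Bad)); last by lra.
  apply: cmu_le => t /= ht; apply: contrapT => nb; move: ht; apply/negP; rewrite -leNgt.
  have := main t S nb (leqnn _); rewrite -evalsum -/Pf.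
  rewrite (_ : \sum_(s < S) al s * expi t ^+ m s = H.[expi t]).
    by move=> h; apply: (le_trans h); rewrite mulrC ler_wpM2r//; lra.
  have := alsum t M 0%N (leq0n w); rewrite addn0 big_ord0 mul0r addr0.
  by rewrite divff ?mul1r// pnatr_eq0.
- move=> k.
  have [j [_ jS tk]] := @take_sum_blocks _ P lo 0 S.-1 k loS lo1 loP (leq0n k).
  rewrite add0n prednK// in jS tk.
  have [j' hj'] := evalT j k.
  exists ((j %/ w)%N%:R / M%:R).
    rewrite divr_ge0//= ler_pdivrMr// mul1r ler_nat.
    by rewrite -ltnS ltn_divLR// mulSn (leq_trans jS)// leq_addl.
  apply: (@le_trans _ _ (cmu Bad +
     cmu [set t | C < nm (take_poly j' A).[expi ((ns j)%:R * t)]])); last first.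
    have : cmu [set t | C < nm (take_poly j' A).[expi ((ns j)%:R * t)]] <= e / 2.
      apply: le_trans (AC j'); apply: (cmu_dilation (is_trig_horner _)) => //.
        exact: ltW.
      by rewrite /C; lra.
    by move: muBad; lra.
  apply: cmu_leU => t /= ht; apply: contrapT => /not_orP[nb /negP]; rewrite -leNgt => hC.
  move: ht; apply/negP; rewrite -leNgt.
  rewrite /Pf tk hornerD mulrDr evalsum.
  have h1 := main t j nb (ltnW jS).
  have rw : (j %% w <= w)%N by rewrite ltnW// ltn_mod.
  have h2 := alsum t (j %/ w)%N (j %% w)%N rw; rewrite -divn_eq in h2.
  rewrite h2 in h1.
  have qE : ((j %/ w)%N%:R / M%:R : R)%:C = (j %/ w)%N%:R / M%:R :> R[i].
    by rewrite rmorphM fmorphV !rmorph_nat.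
  rewrite qE; set x := \sum_(s < j) _ in h1 *; set y := _ / M%:R * _ in h1 *.
  set v := expi t ^+ d * _; set u := (\sum_(k0 < _) _) / _ in h1.
  have h3 : nm v <= cs / M%:R * C.
    by rewrite hj'; apply: ler_pM; rewrite ?nm_ge0.
  have h4 : nm u <= cs / M%:R.
    rewrite /u nmM; have -> : (M%:R^-1 : R[i]) = (M%:R^-1)%:C by rewrite fmorphV rmorph_nat.
    rewrite nm_real ger0_norm ?invr_ge0 ?(ltW M0)// ler_wpM2r ?invr_ge0 ?(ltW M0)//.
    apply: le_trans (nm_sum _ _ _) _; rewrite -csE (big_ord_widen _ (fun k => nm (H`_k * expi t ^+ k)) rw).
    rewrite [leRHS](bigID (fun i : 'I__ => (i < j %% w)%N))/= ler_wpDr//.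
      by apply: sumr_ge0 => i _; exact: nm_ge0.
    by apply: ler_sum => i _; rewrite nmM nmX nm_expi expr1n mulr1.
  (* The finished progressions minus their targets, then the unfinished cycle u and the cut dilate
     v, of total size at most (1 + C) cs / M. *)
  have -> : x + v - y = (x - (y + u)) + (u + v) by ring.
  apply: (le_trans (nmD _ _)); have h5 := nmD u v.
  have h6 : cs / M%:R * (1 + C) <= cs * (e / 2).
    by rewrite -mulrA ler_wpM2l// mulrC.
  have : nm (u + v) <= cs / M%:R * (1 + C) by rewrite mulrDr mulr1; lra.
  lra.
Qed.

End block.

(** * The spectrum *)

Section assembly.
Context {R : realType}.

Lemma coefsum_mulXn (g : {poly R[i]}) k : coefsum (g * 'X^k) = coefsum g.
Proof.
have [->|g0] := eqVneq g 0; first by rewrite mul0r.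
elim: k => [|k ih]; first by rewrite expr0 mulr1.
have gk0 : g * 'X^k != 0 by rewrite mulf_neq0// monic_neq0// monicXn.
rewrite exprSr mulrA -ih /coefsum size_mulX// big_ord_recl coefMX eqxx nm0 add0r.
by apply: eq_bigr => i _; rewrite coefMX.
Qed.

(** Shifting g by z^(d - D) leaves [coefsum] unchanged. The truncations are close to q h with 0 <= q
    <= 1, hence the bound by |h|. *)
Lemma represents_trig d (e : R) l (h : R -> R[i]) D (g : {poly R[i]}) :
  represents d e l -> (size g <= D.*2.+1)%N ->
  (forall t, h t * expi t ^+ D = g.[expi t]) -> (D <= d)%N ->
  exists P : {poly R[i]}, [/\ forall k, P`_k != 0 -> k \in l,
    cmu [set t | e * coefsum g < nm (P.[expi t] - h t)] <= e &
    forall k, cmu [set t | e * coefsum g + nm (h t) < nm (take_poly k P).[expi t]] <= e].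
Proof.
move=> rl sg hg Dd.
have sgd : (size (g * 'X^(d - D))%R <= d.*2.+1)%N.
  apply: leq_trans (size_polyMleq _ _) _; rewrite size_polyXn; move: sg Dd.
  by move: (size g) => x; lia.
have gE t : (g * 'X^(d - D)).[expi t] = expi t ^+ d * h t.
  by rewrite hornerM hornerXn -hg -mulrA -exprD subnKC// mulrC.
have [P [Pl Pf Pp]] := rl _ sgd; rewrite coefsum_mulXn in Pf Pp.
exists P; split=> //.
  apply: le_trans Pf; apply: cmu_le => t /=.
  by rewrite gE -mulrBr nmM nmX nm_expi expr1n mul1r.
move=> k; have [q /andP[q0 q1] hq] := Pp k; apply: le_trans hq; apply: cmu_le => t /=.
rewrite gE => ht; rewrite mulrCA -mulrBr nmM nmX nm_expi expr1n mul1r.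
have h1 := nmD ((take_poly k P).[expi t] - q%:C * h t) (q%:C * h t).
rewrite subrK in h1; rewrite -(ltrD2r (nm (h t))).
apply: (lt_le_trans ht); apply: (le_trans h1); rewrite lerD2l nmM nm_real ger0_norm//.
by rewrite -[leRHS]mul1r ler_wpM2r ?nm_ge0.
Qed.

Variable eps : nat -> R.
Hypothesis eps_gt0 : forall n, (1 <= n)%N -> 0 < eps n.
Hypothesis eps_cvg0 : eps n @[n --> \oo] --> (0 : R).

(** L depends on i only; filler is then added until eps p (L + 1) < 1 for all later indices p. *)
Lemma sparse_extend i l : sparse eps l -> exists l',
  [/\ sparse eps (l ++ l'), l' != [::] & represents i (i.+1%:R^-1 : R) l'].
Proof.
move=> sl; have e0 : 0 < i.+1%:R^-1 :> R by rewrite invr_gt0.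
have [L hL] := sparse_block eps_gt0 i e0.
have L0 : 0 < L.+1%:R^-1 :> R by rewrite invr_gt0.
have /cvgrPdist_lt/(_ _ L0) [p0 _ hp0] := eps_cvg0.
have [l1 [sl1 pl1 l10]] := sparse_filler p0 sl.
have [|l2 [sl2 rl2]] := hL _ sl1.
  move=> p hp; rewrite -ltr_pdivlMr// mul1r.
  have := hp0 p (leq_trans pl1 (ltnW hp)); rewrite /= sub0r normrN.
  exact/le_lt_trans/ler_norm.
exists (l1 ++ l2); split; rewrite ?catA//; first by case: l1 l10 {sl1 pl1 sl2}.
move=> H sH; have [P [P1 P2 P3]] := rl2 H sH; exists P; split=> // k /P1.
by rewrite mem_cat => ->; rewrite orbT.
Qed.

Lemma sparse_tower : exists2 Ls : nat -> seq nat, forall i, sparse eps (Ls i) &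
  forall i, exists l', [/\ Ls i.+1 = Ls i ++ l', l' != [::] &
    represents i (i.+1%:R^-1 : R) l'].
Proof.
have H (x : nat * seq nat) : exists l', sparse eps x.2 ->
    [/\ sparse eps (x.2 ++ l'), l' != [::] & represents x.1 (x.1.+1%:R^-1 : R) l'].
  have [s|s] := pselect (sparse eps x.2); last by exists [::].
  by have [l' h] := sparse_extend x.1 s; exists l'.
have [f fP] := choice H.
pose Ls := fix Ls i := if i is i'.+1 then Ls i' ++ f (i', Ls i') else [::].
have sL i : sparse eps (Ls i).
  elim: i => [|i ih]; first exact: sparse_nil.
  by have [] := fP (i, Ls i) ih.
exists Ls => // i; exists (f (i, Ls i)).
by have [_ h1 h2] := fP (i, Ls i) (sL i).
Qed.

Section spectrum.
Variable Ls : nat -> seq nat.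
Hypothesis sL : forall i, sparse eps (Ls i).
Hypothesis LsS : forall i, exists l', [/\ Ls i.+1 = Ls i ++ l', l' != [::] &
    represents i (i.+1%:R^-1 : R) l'].

(** [Ls n] has at least n entries and later lists extend it, so its n-th entry, counted from 1, is
    final. *)
Definition tower_seq n := nth 0%N (Ls n) n.-1.

Lemma size_tower i : (i <= size (Ls i))%N.
Proof.
elim: i => // i ih; have [l' [-> l'0 _]] := LsS i.
rewrite size_cat -addn1 leq_add//.
by case: l' l'0.
Qed.

Lemma nth_tower i k j : (j < size (Ls i))%N -> nth 0 (Ls (k + i)%N) j = nth 0 (Ls i) j.
Proof.
move=> ji; elim: k => // k ih; rewrite addSn; have [l' [-> _ _]] := LsS (k + i).
rewrite nth_cat ifT//; apply: leq_trans ji _.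
elim: k {ih l'} => // k ih; rewrite addSn; have [l' [-> _ _]] := LsS (k + i).
by rewrite size_cat (leq_trans ih)// leq_addr.
Qed.

Lemma tower_seqE i n : (0 < n)%N -> (n <= size (Ls i))%N -> tower_seq n = nth 0 (Ls i) n.-1.
Proof.
move=> n0 ni; have h1 : (n.-1 < size (Ls i))%N by rewrite prednK.
have h2 : (n.-1 < size (Ls n))%N by rewrite prednK// size_tower.
by rewrite /tower_seq -(nth_tower i h2) addnC (nth_tower n h1).
Qed.

Lemma tower_seq_gt0 n : (1 <= n)%N -> (0 < tower_seq n)%N.
Proof.
by move=> n1; have [h _] := sL n; apply: h; rewrite prednK// size_tower.
Qed.

Lemma tower_seq_ratio n : (1 <= n)%N ->
  (1 + eps n) * (tower_seq n)%:R < (tower_seq n.+1)%:R.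
Proof.
move=> n1; have s1 := size_tower n.+1.
rewrite (tower_seqE n1 (ltnW s1)) (tower_seqE (ltn0Sn n) s1).
have [_ /(_ n.-1)] := sL n.+1; rewrite prednK// => h; exact: h.
Qed.

Lemma tower_seq_lt n : (1 <= n)%N -> (tower_seq n < tower_seq n.+1)%N.
Proof.
move=> n1; rewrite -(ltr_nat R); apply: le_lt_trans (tower_seq_ratio n1).
by rewrite -[leLHS]mul1r ler_wpM2r// lerDl ltW// eps_gt0.
Qed.

Definition tower_set : set int := [set (tower_seq n)%:Z | n in [set n : nat | (1 <= n)%N]].

Lemma mem_tower i k : k \in Ls i -> tower_set k%:Z.
Proof.
move=> /(nthP 0%N) [j jL <-]; exists j.+1 => //=.
by rewrite (@tower_seqE i j.+1).
Qed.

(** One more than the largest entry: the frequencies added between [Ls i] and [Ls i.+1] lie in [top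
    i, top (i + 1)). *)
Let top i := (last 0%N (Ls i)).+1.

Lemma mem_tower_lt i k : k \in Ls i -> (k < top i)%N.
Proof.
move=> /(nthP 0%N) [j jL <-]; rewrite /top (last_nth 0%N).
case E : (size (Ls i)) jL => [|s] //; rewrite ltnS leq_eqVlt => /orP[/eqP->|js] /=; first by [].
rewrite ltnS; have := @sparse_lt _ _ eps_gt0 (Ls i) j s (sL i) js; rewrite E => /(_ (ltnSn s)).
exact: ltnW.
Qed.

Lemma mem_tower_next i k l' : Ls i.+1 = Ls i ++ l' -> k \in l' ->
  (top i <= k)%N /\ (k < top i.+1)%N.
Proof.
move=> E kl; split; last by apply: mem_tower_lt; rewrite E mem_cat kl orbT.
move: kl => /(nthP 0%N) [j jL <-].
have jL1 : (size (Ls i) + j < size (Ls i.+1))%N by rewrite E size_cat ltn_add2l.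
have nE : nth 0 l' j = nth 0 (Ls i.+1) (size (Ls i) + j).
  by rewrite E nth_cat ltnNge leq_addr /= addKn.
rewrite nE /top (last_nth 0%N); case S : (size (Ls i)) jL1 => [|s] jL1 /=.
  by have [h _] := sL i.+1; exact: h.
have -> : nth 0 (Ls i) s = nth 0 (Ls i.+1) s by rewrite E nth_cat S ltnSn.
by apply: (sparse_lt eps_gt0) => //; rewrite addSn ltnS leq_addr.
Qed.

Lemma top_leS i : (top i <= top i.+1)%N.
Proof.
have [l' [E l0 _]] := LsS i; case: l' l0 E => // x l' _ E.
have [h1 h2] := @mem_tower_next i x _ E (mem_head _ _).
by rewrite (leq_trans h1)// ltnW.
Qed.

Lemma top_ge i : (i < top i)%N.
Proof.
rewrite /top (last_nth 0%N); case E : (size (Ls i)) => [|s] /=.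
  by have := size_tower i; rewrite E leqn0 => /eqP->.
rewrite ltnS; apply: (leq_trans (size_tower i)); rewrite E.
by apply: (sparse_ge eps_gt0) => //; rewrite E.
Qed.

Lemma top_le i j : (i <= j)%N -> (top i <= top j)%N.
Proof. by move=> ij; apply: (homo_leq (@leqnn) leq_trans top_leS). Qed.

(** A trigonometric polynomial h close to f - S is realized in a block so far out that its relative
    error times [coefsum g] is negligible. The truncations are controlled by |h|, hence by |f -
    S|. *)
Lemma greedy_step (f : R -> R[i]) j i0 (S : {poly R[i]}) : trig_approx f ->
  exists iP : nat * {poly R[i]}, [/\ (i0 <= iP.1)%N,
    forall k, iP.2`_k != 0 -> exists2 l', Ls iP.1.+1 = Ls iP.1 ++ l' & k \in l',
    cmu [set t | j.+1%:R^-1 < nm (f t - (S + iP.2).[expi t])] <= j.+1%:R^-1 &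
    forall k (tau : R), cmu [set t | 2 / j.+1%:R + tau < nm (take_poly k iP.2).[expi t]] <=
      2 / j.+1%:R + cmu [set t | tau < nm (f t - S.[expi t])]].
Proof.
move=> af; pose v : R := j.+1%:R^-1.
have v0 : 0 < v by rewrite invr_gt0.
have v2 : 0 < v / 2 by rewrite divr_gt0.
have [h [D [c [g [sg hg _]]]] hf] : exists2 h, is_trig h &
    cmu [set t | v / 2 < nm ((f t - S.[expi t]) - h t)] <= v / 2.
  have := trig_approxD af (trig_approx_trig (is_trigB (is_trig_cst 0) (is_trig_horner S))).
  move=> /(_ _ v2) [h th hh]; exists h => //.
  apply: le_trans hh; apply: cmu_le => t /=.
  by rewrite sub0r.
have cg := coefsum_ge0 g.
pose K := (Num.trunc ((1 + coefsum g) / (v / 2))).+1.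
pose i := (i0 + D + K)%N.
have ei : (i.+1%:R^-1 : R) * (1 + coefsum g) <= v / 2.
  rewrite mulrC ler_pdivrMr// mulrC -ler_pdivrMr//.
  apply: ltW; apply: lt_le_trans (truncnS_gt _) _; rewrite ler_nat -/K /i.
  by rewrite -addnS; lia.
have i0' : 0 < i.+1%:R^-1 :> R by rewrite invr_gt0.
have ei1 : (i.+1%:R^-1 : R) <= v / 2.
  by apply: le_trans ei; rewrite -[leLHS]mulr1 ler_wpM2l ?(ltW i0')// lerDl.
have ei2 : (i.+1%:R^-1 : R) * coefsum g <= v / 2.
  by apply: le_trans ei; rewrite ler_wpM2l ?(ltW i0')// lerDr.
have [l' [E _ rl]] := LsS i.
have [|P [Pl Pf Pp]] := represents_trig rl sg hg; first by rewrite /i; lia.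
exists (i, P); split=> /=; first by rewrite /i; lia.
- by move=> k /Pl kl; exists l'.
- apply: (@le_trans _ _ (v / 2 + v / 2)); last by rewrite -splitr.
  apply: (@le_trans _ _ (cmu [set t | v / 2 < nm (f t - S.[expi t] - h t)] +
     cmu [set t | i.+1%:R^-1 * coefsum g < nm (P.[expi t] - h t)])).
    apply: cmu_leU => t /=; rewrite hornerD opprD addrA => ht.
    have [h1|h1] := ltP (v / 2) (nm (f t - S.[expi t] - h t)); [by left|right].
    have := nm_triangle (f t - S.[expi t]) (h t) P.[expi t].
    rewrite [nm (h t - _)]nm_distC => h2.
    by have := lt_le_trans ht h2; rewrite -/v /= => h3; apply: (le_lt_trans ei2); lra.
  by apply: lerD => //; exact: le_trans ei1.
- move=> k tau; rewrite -/v.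
  apply: (@le_trans _ _ (cmu [set t | i.+1%:R^-1 * coefsum g + nm (h t) < nm (take_poly k P).[expi t]]
    + cmu ([set t | v / 2 < nm (f t - S.[expi t] - h t)] `|` [set t | tau < nm (f t - S.[expi t])]))).
    apply: cmu_leU => t /= ht.
    have [h1|h1] := ltP (i.+1%:R^-1 * coefsum g + nm (h t)) (nm (take_poly k P).[expi t]); [by left|right].
    have [h2|h2] := ltP (v / 2) (nm (f t - S.[expi t] - h t)); [by left|right].
    have := nmB (f t - S.[expi t]) (f t - S.[expi t] - h t).
    rewrite opprB addrC subrK /= => h3.
    by have := lt_le_trans ht h1; move: ei2; move: (_ * coefsum g) => q; lra.
  have := cmuU [set t | v / 2 < nm (f t - S.[expi t] - h t)] [set t | tau < nm (f t - S.[expi t])].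
  have := le_trans (Pp k) ei1; lra.
Qed.

(** As c vanishes off the spectrum, the sum may run over all 0 <= k <= N. *)
Lemma partial_sumE (c : nat -> R[i]) (S : {poly R[i]}) N t :
  (forall k, (k <= N)%N -> S`_k = c k) -> (forall k, c k != 0 -> tower_set k%:Z) ->
  spectral_partial_sum tower_set (fun k => c `|k|%N) N t = (take_poly N.+1 S).[expi t].
Proof.
move=> cS c0; rewrite /spectral_partial_sum.
have st : (size (take_poly N.+1 S) <= N.+1)%N by exact: size_take_poly.
rewrite (horner_coef_wide _ st).
pose F (k : int) : R[i] := c `|k|%N * expi (k%:~R * t).
rewrite (fsbig_widen _ [set (k : nat)%:Z | k in `I_N.+1]); first last.
- move=> k [[m /= mN <-] hm]; have [->|cm] := eqVneq (c `|m|%N) 0; first by rewrite mul0r.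
  exfalso; apply: hm; split; first exact: c0.
  by rewrite /= ger0_norm// lez_nat -ltnS.
- move=> _ [[n n1 <-]]; rewrite /= ger0_norm// lez_nat => h.
  by exists (tower_seq n) => //=; rewrite ltnS.
rewrite (reindex_fsbig (fun k : nat => k%:Z) `I_N.+1); last first.
  split=> //.
  by move=> a b _ _ [].
rewrite -fsbig_ord; apply: eq_bigr => k _.
by rewrite coef_take_poly ltn_ord cS -1?ltnS// -expiMn.
Qed.

(** Greedy expansion, one block per step. A cut falls in one block; the sum before it is close to f
    in measure, and the cut block is about as small as the remainder it corrects. *)
Lemma tower_menshov : menshov_spectrum_in_measure R tower_set.
Proof.
move=> f /trig_approx_L0 af.
have [F FP] := choice (fun x : nat * (nat * {poly R[i]}) =>
  greedy_step x.1 x.2.1 x.2.2 af).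
(* The first component is the lowest block index still allowed, so the blocks used strictly
   increase. *)
pose st := fix st j := if j is j'.+1 then
  ((F (j', st j')).1.+1, (st j').2 + (F (j', st j')).2) else (0%N, 0 : {poly R[i]}).
pose i j := (F (j, st j)).1; pose P j := (F (j, st j)).2; pose S j := (st j).2.
have SE J : S J = \sum_(j < J) P j.
  by elim: J => [|J ih]; rewrite ?big_ord0// big_ord_recr /= -ih.
have iS j : (i j < i j.+1)%N by have [] := FP (j.+1, st j.+1).
have ij j : (j <= i j)%N by elim: j => // j ih; exact: leq_ltn_trans (iS j).
pose lo j := top (i j).
have Psupp j k : (P j)`_k != 0 -> (top (i j) <= k)%N /\ (k < top (i j).+1)%N.
  by move=> h; have [_ /(_ k h) [l' E kl] _ _] := FP (j, st j); exact: mem_tower_next kl.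
have loS j : (size (P j) <= lo j.+1)%N.
  apply/leq_sizeP => k hk; apply/eqP; apply: contraLR hk => /Psupp [_ h].
  by rewrite -ltnNge (leq_trans h)// /lo top_le.
have lo1 j : (lo j <= lo j.+1)%N by rewrite /lo top_le// ltnW.
have loP j k : (k < lo j)%N -> (P j)`_k = 0.
  by move=> hk; apply/eqP; apply: contraLR hk => /Psupp [h _]; rewrite -leqNgt.
have jlo j : (j < lo j)%N by apply: leq_ltn_trans (ij j) (top_ge _).
(* P_j has only frequencies above j, so the coefficient of index k no longer changes from S_(k+1)
   on. *)
pose c k := (S k.+1)`_k.
have cS J k : (k < J)%N -> (S J)`_k = c k.
  elim: J => // J ih; rewrite ltnS leq_eqVlt => /orP[/eqP->//|kJ].
  rewrite -ih// [S J.+1]/S /= coefD -/(S J) -/(P J) loP ?addr0//.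
  exact: ltn_trans kJ (jlo J).
have cT k : c k != 0 -> tower_set k%:Z.
  rewrite /c SE coef_sum => h.
  have [j hj] : exists j : 'I_k.+1, (P j)`_k != 0.
    apply/existsP; apply: contraNT h => /existsPn h; rewrite big1// => j _.
    by have := h j; rewrite negbK => /eqP.
  have [_ /(_ k hj) [l' E kl] _ _] := FP (nat_of_ord j, st j).
  by apply: (@mem_tower (i j).+1); rewrite E mem_cat kl orbT.
exists (fun k => c `|k|%N) => e e0.
pose G N := cmu [set t | e < nm (spectral_partial_sum tower_set (fun k => c `|k|%N) N t - f t)].
suff GN : G N @[N --> \oo] --> (0 : R).
  have -> : (fun N => circle_measure [set t | e%:C < `|spectral_partial_sum tower_set (fun k => c `|k|%N) N t - f t|]) = EFin \o G.
    apply/funext => N /=; rewrite cmuE /G; congr (_%:E); congr cmu.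
    by apply/seteqP; split=> t /=; rewrite -nmE ltcR.
  by apply: cvg_EFin => //; exact: nearW.
apply/cvgrPdist_le => y y0.
pose z := Num.min e y; have z0 : 0 < z by rewrite lt_min e0 y0.
have ze : z <= e by rewrite ge_min lexx.
have zy : z <= y by rewrite ge_min lexx orbT.
(* 4/J0 <= z covers both the error v + (2w + v) and the measure 2w + 2v found below, as w <= v <=
   1/J0. *)
pose J0 := (Num.trunc (4 / z)).+1.
have J0z : 4 / J0%:R <= z.
  rewrite ler_pdivrMr ?ltr0n// mulrC -ler_pdivrMr//.
  by apply: ltW; exact: truncnS_gt.
exists (lo J0) => // N /= hN.
rewrite sub0r normrN ger0_norm ?cmu_ge0//; apply: le_trans zy.
(* The cut is at N + 1 because [take_poly] keeps indices strictly below its bound; after J0 + N + 1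
   blocks all coefficients up to N are final. *)
have [j [J0j _ tk]] := @take_sum_blocks _ P lo J0 N N.+1 loS lo1 loP (leq_trans hN (leqnSn N)).
rewrite -!SE in tk.
have NJ : (N < J0 + N.+1)%N by lia.
have pE t : spectral_partial_sum tower_set (fun k => c `|k|%N) N t =
    (S j).[expi t] + (take_poly N.+1 (P j)).[expi t].
  rewrite -hornerD -tk; apply: partial_sumE => // k kN; apply: cS.
  exact: leq_ltn_trans NJ.
(* J0 >= 1 rules out j = 0, so at least one greedy step precedes the cut block. *)
case: j J0j tk pE => // j J0j tk pE.
have [_ _ hS _] := FP (j, st j).
have [_ _ _ hT] := FP (j.+1, st j.+1).
set v : R := j.+1%:R^-1 in hS.
have {hT} := hT N.+1 v.
rewrite -/(P j.+1) -/(S j.+1) /=; rewrite /= -/(S j) -/(P j) -[(S j + P j)]/(S j.+1) in hS.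
set w : R := j.+2%:R^-1 => hT.
have v0 : 0 < v by rewrite invr_gt0.
have w0 : 0 < w by rewrite invr_gt0.
have wv : w <= v by rewrite lef_pV2 ?posrE// ler_nat.
have vz : 4 * v <= z.
  apply: le_trans J0z; rewrite ler_wpM2l// lef_pV2 ?posrE// ?ler_nat//.
apply: (@le_trans _ _ (cmu [set t | 2 * w + v < nm (take_poly N.+1 (P j.+1)).[expi t]] +
   cmu [set t | v < nm (f t - (S j.+1).[expi t])])); last by lra.
apply: cmu_leU => t /=; rewrite pE => ht.
have [h|h] := ltP v (nm (f t - (S j.+1).[expi t])); [by right|left].
have := nmD ((S j.+1).[expi t] - f t) (take_poly N.+1 (P j.+1)).[expi t].
by rewrite addrAC (nm_distC (S j.+1).[expi t] (f t)) /= => h2; have := lt_le_trans ht h2; lra.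
Qed.

End spectrum.

End assembly.

Theorem theorem5 (R : realType) (eps : nat -> R)
    (eps_gt0 : forall n : nat, (1 <= n)%N -> 0 < eps n)
    (eps_cvg0 : eps n @[n --> \oo] --> (0 : R)) :
  exists lambda : nat -> nat,
    [/\ forall n : nat, (1 <= n)%N -> (0 < lambda n)%N,
        forall n : nat, (1 <= n)%N -> (lambda n < lambda n.+1)%N,
        menshov_spectrum_in_measure R
          [set (lambda n)%:Z | n in [set n : nat | (1 <= n)%N]] &
        forall n : nat, (1 <= n)%N ->
          (lambda n.+1)%:R / (lambda n)%:R > 1 + eps n :> R].
Proof.
have [Ls sL LsS] := sparse_tower eps_gt0 eps_cvg0.
exists (tower_seq Ls); split=> n.
- exact: (tower_seq_gt0 sL LsS).
- exact: (tower_seq_lt eps_gt0 sL LsS).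
- exact: (tower_menshov eps_gt0 sL LsS).
- move=> n1; rewrite ltr_pdivlMr; first exact: (tower_seq_ratio sL LsS).
  by rewrite ltr0n (tower_seq_gt0 sL LsS).
Qed.
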